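(* The system $$\frac{dr}{dz}=\frac{\mathcal G A R}{\mathcal G E'R-\mathcal F}-\frac{R_z\,(M\mathcal G-R)\sqrt{1+2E}}{R\,(\delta\sigma\sqrt{2E+2M/R}-\sqrt{1+2E})(\mathcal G E'R-\mathcal F)},$$ $$\frac{dt}{dz}=\frac{\delta R_z}{\delta\sigma\sqrt{2E+2M/R}-\sqrt{1+2E}},$$ $$\frac{dM}{dz}=\frac{-\mathcal F R A}{\mathcal G E'R-\mathcal F}-\frac{R_z\,(R^2E'-\mathcal F M)\sqrt{1+2E}}{R\,(\delta\sigma\sqrt{2E+2M/R}-\sqrt{1+2E})(\mathcal G E'R-\mathcal F)}$$ is locally solvable at any point of $\mathfrak O^\pm$ where $\delta\neq\sigma$ or where $2M\ne R$, if either of the following holds there: (1) $\operatorname{sgn}E'\ne\operatorname{sgn}R_0'$; (2) $\displaystyle\left|\frac{E'\,(R_0-R)^2}{2M\sqrt{27E}}\right|<\left|\frac{R_0'\sqrt{R_0}}{\sqrt{ER_0+M}}\right|.$ That is, given initial values $r_0,\tau_0,M_0>0$ at $z_0$ (for which $\delta\neq\sigma$ or $2M\neq R$ holds, and (1) or (2) holds) and smooth $E,R,R_0'>0$, the system has on an open interval $I\ni z_0$ a unique solution $\vec X=(r,t,M)^T$ satisfying $\vec X(z_0)=(r_0,\tau_0,M_0)^T$.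
   Context: A prime denotes $d/dr$. The data are smooth functions $E(r)$, $R_0(r)$ and a smooth positive function $R=R[z]$, with $R_z=dR[z]/dz$; $\sigma,\delta\in\{\pm1\}$ are constants (in the underlying Lemaître–Tolman–Bondi model, $\sigma=\operatorname{sgn}\partial_tR$, $\delta=\operatorname{sgn}\partial_rR$, where $R(t,r)$ solves $\partial_tR=\sigma\sqrt{2E+2M/R}$, $R(t_0,r)=R_0(r)$ with $t_0>0$ fixed). In the system, $R=R[z]$, $E=E(r(z))$, $E'=E'(r(z))$, $R_0=R_0(r(z))$, $R_0'=R_0'(r(z))$. One restricts to $R,R_0,t>0$, $M\ge -ER$, $E>0$, and it is a standing assumption that $\partial_tR,\partial_rR,\partial^2_{t,r}R\neq0$. Set $$B=\frac{\sigma\sqrt{2E+2M/R}}{1+z},\qquad A=B\sqrt{1+2E},$$ $$J(R,R_0,M,E,t)=\sqrt2(t-t_0)-\sigma\int_{R_0}^R\sqrt{\frac{\tau}{\tau E+M}}\,d\tau ,$$ and define $\mathcal F,\mathcal G$ by $-(\partial_RJ)\mathcal F=E'\partial_EJ+R_0'\partial_{R_0}J$ and $-(\partial_RJ)\mathcal G=\partial_MJ$. $\mathfrak O^\pm$ denotes the smooth manifold of points $(R,R_0,E,M,t)$ in the region $R,R_0,t>0$, $M\ge -ER$, $E>0$ with $J=0$, for $\sigma=\pm1$ respectively. *)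

(* Defs.v *)
From Stdlib Require Import Reals.
From Coquelicot Require Import Coquelicot.
Open Scope R_scope.

(* Values of R, R_0, M, E are written rho, rho0, m, e; de and drho0 are the
   values of E' and R_0'.  The unknown functions of z are r, t, M. *)

Definition smooth_on (D : R -> Prop) (f : R -> R) : Prop :=
  forall (n : nat) (x : R), D x -> ex_derive_n f n x.

Definition J (sigma t0 rho rho0 m e t : R) : R :=
  sqrt 2 * (t - t0) -
  sigma * RInt (fun tau => sqrt (tau / (tau * e + m))) rho0 rho.

Definition dJ_R (sigma t0 rho rho0 m e t : R) : R :=
  Derive (fun x => J sigma t0 x rho0 m e t) rho.
Definition dJ_R0 (sigma t0 rho rho0 m e t : R) : R :=
  Derive (fun x => J sigma t0 rho x m e t) rho0.
Definition dJ_M (sigma t0 rho rho0 m e t : R) : R :=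
  Derive (fun x => J sigma t0 rho rho0 x e t) m.
Definition dJ_E (sigma t0 rho rho0 m e t : R) : R :=
  Derive (fun x => J sigma t0 rho rho0 m x t) e.

(* Solutions of - dJ_R * F = E' * dJ_E + R_0' * dJ_R0 and - dJ_R * G = dJ_M. *)
Definition F (sigma t0 rho rho0 m e t de drho0 : R) : R :=
  - (de * dJ_E sigma t0 rho rho0 m e t + drho0 * dJ_R0 sigma t0 rho rho0 m e t)
  / dJ_R sigma t0 rho rho0 m e t.
Definition G (sigma t0 rho rho0 m e t : R) : R :=
  - dJ_M sigma t0 rho rho0 m e t / dJ_R sigma t0 rho rho0 m e t.

Definition B (sigma z rho m e : R) : R :=
  sigma * sqrt (2 * e + 2 * m / rho) / (1 + z).
Definition A (sigma z rho m e : R) : R :=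
  B sigma z rho m e * sqrt (1 + 2 * e).

Definition region (rho rho0 e m t : R) : Prop :=
  0 < rho /\ 0 < rho0 /\ 0 < t /\ - e * rho <= m /\ 0 < e.

Definition in_O (sigma t0 rho rho0 e m t : R) : Prop :=
  region rho rho0 e m t /\ J sigma t0 rho rho0 m e t = 0.

(* The two factors occurring in the denominators of the system. *)
Definition den1 (sigma t0 rho rho0 m e t de drho0 : R) : R :=
  G sigma t0 rho rho0 m e t * de * rho - F sigma t0 rho rho0 m e t de drho0.
Definition den2 (sigma delta rho m e : R) : R :=
  delta * sigma * sqrt (2 * e + 2 * m / rho) - sqrt (1 + 2 * e).

(* In the three right-hand sides, drho is the value of R_z. *)
Definition rhs_r (sigma delta t0 z rho drho rho0 drho0 e de m t : R) : R :=
  G sigma t0 rho rho0 m e t * A sigma z rho m e * rho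
    / den1 sigma t0 rho rho0 m e t de drho0
  - drho * (m * G sigma t0 rho rho0 m e t - rho) * sqrt (1 + 2 * e)
    / (rho * den2 sigma delta rho m e
       * den1 sigma t0 rho rho0 m e t de drho0).

Definition rhs_t (sigma delta rho drho e m : R) : R :=
  delta * drho / den2 sigma delta rho m e.

Definition rhs_M (sigma delta t0 z rho drho rho0 drho0 e de m t : R) : R :=
  - F sigma t0 rho rho0 m e t de drho0 * rho * A sigma z rho m e
    / den1 sigma t0 rho rho0 m e t de drho0
  - drho * (rho ^ 2 * de - F sigma t0 rho rho0 m e t de drho0 * m)
    * sqrt (1 + 2 * e)
    / (rho * den2 sigma delta rho m e
       * den1 sigma t0 rho rho0 m e t de drho0).

(* Division, sqrt, RInt and Derive are total, so a solution is required to stay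
   where every expression in the system is genuinely defined; the condition on
   tau makes the integrand of J continuous on the segment of integration. *)
Definition well_defined
    (sigma delta t0 z rho rho0 drho0 e de m t : R) : Prop :=
  1 + z <> 0 /\
  region rho rho0 e m t /\
  (forall tau, Rmin rho0 rho <= tau <= Rmax rho0 rho -> 0 < tau * e + m) /\
  den1 sigma t0 rho rho0 m e t de drho0 <> 0 /\
  den2 sigma delta rho m e <> 0.

(* E and R_0 are functions on the open set Dr, Rf is the function z |-> R[z]
   on the open set Dz; (a, b) is the interval of the solution. *)
Definition is_solution (sigma delta t0 : R) (Dr Dz : R -> Prop)
    (E R_0 Rf : R -> R) (a b : R) (r t M : R -> R) : Prop :=
  forall z : R, a < z < b ->
    Dz z /\ Dr (r z) /\
    well_defined sigma delta t0 z (Rf z)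
      (R_0 (r z)) (Derive R_0 (r z)) (E (r z)) (Derive E (r z)) (M z) (t z) /\
    is_derive r z
      (rhs_r sigma delta t0 z (Rf z) (Derive Rf z) (R_0 (r z))
         (Derive R_0 (r z)) (E (r z)) (Derive E (r z)) (M z) (t z)) /\
    is_derive t z
      (rhs_t sigma delta (Rf z) (Derive Rf z) (E (r z)) (M z)) /\
    is_derive M z
      (rhs_M sigma delta t0 z (Rf z) (Derive Rf z) (R_0 (r z))
         (Derive R_0 (r z)) (E (r z)) (Derive E (r z)) (M z) (t z)).

(* Main.v *)
Require Import Defs.
From Stdlib Require Import Reals Lra List.
From Coquelicot Require Import Coquelicot.
Open Scope R_scope.

(** The right-hand sides of the system are locally Lipschitz functions of the
    state near the initial point as soon as no denominator vanishes there, and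
    then the Picard-Lindelof theorem applies.  The two denominators to be
    controlled are [den2] and [den1].

    The first is a difference of two square roots, the one of the squared speed
    [2 * e + 2 * m / rho] being preceded by the sign [delta * sigma].  If the
    sign is negative, [den2] is negative.  Otherwise the roots agree only when
    [2 * m = rho] ([den2_neq_0]).

    For [den1], differentiation under the integral sign expresses the
    derivatives of [J] by integrals of
    [w (tau) = sqrt (tau / (tau * e + m)) / (tau * e + m)], and
    [den1 * sqrt (rho / (rho * e + m))] becomes
    [E' / 2 * N - R_0' * sqrt (rho0 / (rho0 * e + m))], where [N] is the integral
    of [(rho - tau) * w (tau)] from [rho0] to [rho] ([den1_eq]).  For either order
    of the bounds [N] is nonnegative, and since the maximum of [w] is
    [2 / (m * sqrt (27 * e))], it is at most
    [(rho - rho0) ^ 2 / (m * sqrt (27 * e))] ([moment_excess_bounds]).  As [R_0']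
    is positive, the first alternative means [E' <= 0], and the second one says
    that the largest value of [E' / 2 * N] is below the subtracted term; in both
    cases [den1] is negative ([den1_lt_0]).

    Existence and uniqueness ([picard_lindelof]) are proved for autonomous
    systems with finitely many unknowns, the variable [z] being one of them.
    Cutting the field off outside a box around the initial point gives a bounded,
    globally Lipschitz field, for which Picard's integral operator is a
    contraction on a short interval.  On such an interval no solution of the
    original system has the time to leave the box ([solution_confined]), so
    uniqueness holds among all solutions defined there.

    The Lipschitz condition on the right-hand sides follows from its stability
    under arithmetic operations, composition with smooth functions and
    integration with variable bounds and parameters ([locally_lipschitz_RInt]),
    applied to the integral formulas for the derivatives of [J]. *)

(** * Preliminaries on real functions *)

(** Integrals live in the carrier of [R_CompleteNormedModule], which [ring]
    does not identify with [R]; a sum at the head exposes the type [R]. *)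
Ltac ring_R := apply (Rplus_eq_reg_l 0); ring.

(** The supremum distance is used through upper bounds [C] only, so that it need
    not be finite, let alone attained. *)
Definition sup_close {I : Type} (C : R) (v w : I -> R) : Prop :=
  forall i, Rabs (v i - w i) <= C.

Definition clamp (c d x : R) : R := Rmax (c - d) (Rmin (c + d) x).

Lemma clamp_lipschitz (c d x y : R) :
  Rabs (clamp c d x - clamp c d y) <= Rabs (x - y).
Proof.
unfold clamp, Rmax, Rmin; repeat destruct Rle_dec;
  unfold Rabs; repeat destruct Rcase_abs; lra.
Qed.

Lemma clamp_near (c d x : R) : 0 <= d -> Rabs (clamp c d x - c) <= d.
Proof.
intros; unfold clamp, Rmax, Rmin; repeat destruct Rle_dec;
  unfold Rabs; repeat destruct Rcase_abs; lra.
Qed.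

Lemma clamp_id (c d x : R) : Rabs (x - c) <= d -> clamp c d x = x.
Proof.
intros H%Rabs_le_between'.
unfold clamp; rewrite (Rmin_right _ x), Rmax_right; lra.
Qed.

Lemma lipschitz_continuous (g : R -> R) (K : R) (x : R) :
  (forall y z, Rabs (g y - g z) <= K * Rabs (y - z)) -> continuous g x.
Proof.
intros H P [eps HP].
assert (HK : 0 < Rabs K + 1) by (pose proof (Rabs_pos K); lra).
assert (Hd : 0 < eps / (Rabs K + 1)).
{ apply Rdiv_lt_0_compat; [apply eps | exact HK]. }
exists (mkposreal _ Hd); intros y Hy; apply HP.
change (Rabs (y - x) < eps / (Rabs K + 1)) in Hy.
change (Rabs (g y - g x) < eps).
apply Rle_lt_trans with ((Rabs K + 1) * Rabs (y - x)).
- eapply Rle_trans; [apply H|].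
  apply Rmult_le_compat_r; [apply Rabs_pos|].
  pose proof (Rle_abs K); lra.
- rewrite Rmult_comm; apply Rlt_div_r; assumption.
Qed.

Lemma RInt_abs_le (g : R -> R) (a b M : R) :
  ex_RInt g a b ->
  (forall x, Rmin a b <= x <= Rmax a b -> Rabs (g x) <= M) ->
  Rabs (RInt g a b) <= M * Rabs (b - a).
Proof.
intros Hg HM.
destruct (Rle_dec a b) as [Hab|Hab].
- rewrite (Rabs_pos_eq (b - a)), Rmult_comm by lra.
  apply abs_RInt_le_const; try assumption.
  rewrite Rmin_left, Rmax_right in HM by lra; exact HM.
- rewrite <- opp_RInt_swap by (apply ex_RInt_swap, Hg).
  change opp with Ropp.
  rewrite Rabs_Ropp, (Rabs_left1 (b - a)) by lra.
  replace (M * - (b - a)) with ((a - b) * M) by ring.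
  apply abs_RInt_le_const; [lra | apply ex_RInt_swap, Hg |].
  rewrite Rmin_right, Rmax_left in HM by lra; exact HM.
Qed.

Lemma Rabs_le_half_pow_eq_0 (x C : R) :
  (forall n : nat, Rabs x <= C * (/ 2) ^ n) -> x = 0.
Proof.
intros H.
assert (Hl : is_lim_seq (fun n => C * (/ 2) ^ n) (C * 0)).
{ apply (is_lim_seq_scal_l _ C 0), is_lim_seq_geom; rewrite Rabs_pos_eq; lra. }
assert (Hx := is_lim_seq_le _ _ _ _ H (is_lim_seq_const (Rabs x)) Hl).
simpl in Hx; rewrite Rmult_0_r in Hx.
apply Rabs_eq_0, Rle_antisym; [exact Hx | apply Rabs_pos].
Qed.

(** * Solving a globally Lipschitz autonomous system *)

(** Banach's fixed point theorem for the supremum distance on real-valued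
    functions, on a set [Q] of functions closed under pointwise limits.  No
    metric space has to be built: the iterates of [T] stay at bounded distance
    from each other. *)
Lemma contraction_fixed_point (A : Type) (Q : (A -> R) -> Prop)
    (T : (A -> R) -> A -> R) (u0 : A -> R) (C0 : R) :
  (forall (u : nat -> A -> R) l, (forall n, Q (u n)) ->
    (forall a, is_lim_seq (fun n => u n a) (Finite (l a))) -> Q l) ->
  (forall u, Q u -> Q (T u)) ->
  (forall u v C, 0 <= C -> Q u -> Q v -> sup_close C u v ->
    sup_close (C * / 2) (T u) (T v)) ->
  0 <= C0 -> Q u0 -> sup_close C0 u0 (T u0) ->
  exists u, Q u /\ forall a, T u a = u a.
Proof.
intros Qlim QT HT HC0 Q0 Hu0.
(* The increments of the iterates are dominated by C0 / 2 ^ n, so the distance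
   from the n-th iterate to all later ones, and to the limit, is at most
   2 * C0 / 2 ^ n. *)
set (x := fun n => Nat.iter n T u0).
assert (Qx : forall n, Q (x n)).
{ induction n; [exact Q0 | exact (QT _ IHn)]. }
assert (Hpow : forall n, 0 <= C0 * (/ 2) ^ n).
{ intros n; apply Rmult_le_pos; [exact HC0 | apply pow_le; lra]. }
assert (Hstep : forall n, sup_close (C0 * (/ 2) ^ n) (x n) (x (S n))).
{ induction n.
  - simpl; rewrite Rmult_1_r; exact Hu0.
  - replace (C0 * (/ 2) ^ S n) with (C0 * (/ 2) ^ n * / 2) by (simpl; ring).
    apply HT; auto. }
assert (Hdist : forall n k a, Rabs (x n a - x (n + k)%nat a)
                  <= 2 * C0 * (/ 2) ^ n - 2 * C0 * (/ 2) ^ (n + k)).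
{ intros n k a; induction k.
  - rewrite Nat.add_0_r; rewrite !Rminus_diag, Rabs_R0; lra.
  - rewrite Nat.add_succ_r.
    replace (x n a - x (S (n + k)) a)
      with ((x n a - x (n + k)%nat a) + (x (n + k)%nat a - x (S (n + k)) a))
      by ring.
    eapply Rle_trans; [apply Rabs_triang|].
    specialize (Hstep (n + k)%nat a); simpl pow; lra. }
assert (Hdist' : forall n m a, (n <= m)%nat ->
          Rabs (x n a - x m a) <= 2 * C0 * (/ 2) ^ n).
{ intros n m a Hnm.
  replace m with (n + (m - n))%nat
    by (rewrite Nat.add_comm; apply Nat.sub_add; exact Hnm).
  eapply Rle_trans; [apply Hdist|].
  specialize (Hpow (n + (m - n))%nat); lra. }
set (l := fun a => real (Lim_seq (fun n => x n a))).
assert (Hl : forall a, is_lim_seq (fun n => x n a) (l a)).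
{ intros a; apply Lim_seq_correct', ex_lim_seq_cauchy_corr.
  intros eps.
  assert (Hlim : is_lim_seq (fun n => 2 * C0 * (/ 2) ^ n) (2 * C0 * 0)).
  { apply (is_lim_seq_scal_l _ (2 * C0) 0), is_lim_seq_geom.
    rewrite Rabs_pos_eq; lra. }
  rewrite Rmult_0_r in Hlim.
  destruct (proj2 (is_lim_seq_spec _ _) Hlim) with (eps := pos_div_2 eps)
    as [N HN].
  specialize (HN N (le_n N)); rewrite Rminus_0_r in HN.
  apply Rabs_lt_between in HN; simpl in HN.
  exists N; intros n m Hn Hm.
  replace (x n a - x m a) with ((x N a - x m a) - (x N a - x n a)) by ring.
  eapply Rle_lt_trans; [apply Rabs_triang|].
  rewrite Rabs_Ropp.
  pose proof (Hdist' N n a Hn); pose proof (Hdist' N m a Hm); lra. }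
assert (Hxl : forall n, sup_close (2 * C0 * (/ 2) ^ n) (x n) l).
{ intros n a.
  apply (is_lim_seq_le_loc (fun m => Rabs (x n a - x m a))
           (fun _ => 2 * C0 * (/ 2) ^ n)
           (Finite (Rabs (x n a - l a))) (Finite (2 * C0 * (/ 2) ^ n))).
  - exists n; intros m Hm; apply Hdist', Hm.
  - apply (is_lim_seq_abs _ (Finite (x n a - l a))).
    apply is_lim_seq_minus'; [apply is_lim_seq_const | apply Hl].
  - apply is_lim_seq_const. }
assert (Ql : Q l) by (apply (Qlim x); assumption).
exists l; split; [exact Ql|]; intros a.
apply Rminus_diag_uniq, (Rabs_le_half_pow_eq_0 _ (2 * C0)); intros n.
replace (T l a - l a) with ((x (S n) a - l a) - (T (x n) a - T l a))
  by (simpl; ring).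
eapply Rle_trans; [apply Rabs_triang|].
rewrite Rabs_Ropp.
assert (HTn := HT (x n) l _ (Rmult_le_pos 2 _ ltac:(lra) (Hpow n)) (Qx n) Ql).
rewrite <- Rmult_assoc in HTn.
specialize (HTn (Hxl n) a).
pose proof (Hxl (S n) a) as Hn; simpl pow in Hn; lra.
Qed.

(** The upper bound of the integral is clamped to the interval of radius [h],
    so that the operator contracts the supremum distance over the whole line
    and no restriction of the domain is needed; only the values on the interval
    matter in the end. *)
Definition picard {I : Type} (f : I -> (I -> R) -> R) (p : I -> R) (z0 h : R)
    (u : R * I -> R) (a : R * I) : R :=
  p (snd a) + RInt (fun s => f (snd a) (fun j => u (s, j))) z0
                (clamp z0 h (fst a)).

(** On functions that are [K]-Lipschitz in time the operator [picard] is a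
    contraction of ratio [L * h <= 1 / 2].  The Lipschitz condition in time
    survives pointwise limits, and it makes the integrands continuous: this is
    why it is the set on which the fixed point is sought. *)
Lemma picard_solution (I : Type) (f : I -> (I -> R) -> R) (p : I -> R)
    (z0 h K L : R) :
  0 < h -> 0 <= K -> 0 <= L -> L * h <= / 2 ->
  (forall i v, Rabs (f i v) <= K) ->
  (forall v w C, 0 <= C -> sup_close C v w -> forall i,
    Rabs (f i v - f i w) <= L * C) ->
  exists X : R -> I -> R,
    (forall i, X z0 i = p i) /\
    (forall z, sup_close (K * h) (X z) p) /\
    (forall z i, Rabs (z - z0) < h ->
      is_derive (fun s => X s i) z (f i (X z))).
Proof.
intros Hh HK HL HLh Hbd Hlip.
set (Q := fun u : R * I -> R =>
  forall i y z, Rabs (u (y, i) - u (z, i)) <= K * Rabs (y - z)).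
assert (Hcont : forall u, Q u -> forall i z,
          continuous (fun s => f i (fun j => u (s, j))) z).
{ intros u Hu i z; apply (lipschitz_continuous _ (L * K)); intros x y.
  rewrite Rmult_assoc; apply Hlip; [|intros j; apply Hu].
  apply Rmult_le_pos; [exact HK | apply Rabs_pos]. }
assert (Hex : forall u, Q u -> forall i a b,
          ex_RInt (fun s => f i (fun j => u (s, j))) a b).
{ intros u Hu i a b; apply (ex_RInt_continuous (V := R_CompleteNormedModule)).
  intros; apply Hcont, Hu. }
assert (Hz : forall z, Rabs (clamp z0 h z - z0) <= h).
{ intros; apply clamp_near; lra. }
assert (Hclose : forall u, Q u -> sup_close (K * h) (picard f p z0 h u)
          (fun a => p (snd a))).
{ intros u Hu [z i]; unfold picard; simpl.
  replace (p i + _ - p i)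
    with (RInt (fun s => f i (fun j => u (s, j))) z0 (clamp z0 h z))
    by ring_R.
  eapply Rle_trans; [apply RInt_abs_le with (M := K)|].
  - apply Hex, Hu.
  - intros; apply Hbd.
  - apply Rmult_le_compat_l; auto. }
destruct (contraction_fixed_point (R * I) Q (picard f p z0 h)
            (fun a => p (snd a)) (K * h)) as [u [Qu Hu]].
- intros u l Qu Hl i y z.
  refine (is_lim_seq_le _ _ (Finite _) (Finite _) (fun n => Qu n i y z) _
            (is_lim_seq_const _)).
  apply (is_lim_seq_abs _ (Finite _)), is_lim_seq_minus'; apply Hl.
- intros u Qu i y z; unfold picard; simpl.
  set (g := fun s => f i (fun j => u (s, j))).
  rewrite <- (RInt_Chasles g z0 (clamp z0 h z) (clamp z0 h y))
    by (apply Hex, Qu).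
  change plus with Rplus.
  match goal with |- Rabs ?t <= _ =>
    replace t with (RInt g (clamp z0 h z) (clamp z0 h y))
      by ring_R end.
  eapply Rle_trans; [apply RInt_abs_le with (M := K)|].
  + apply Hex, Qu.
  + intros; apply Hbd.
  + apply Rmult_le_compat_l; [exact HK | apply clamp_lipschitz].
- intros u v C HC Qu Qv Huv [z i]; unfold picard; simpl.
  set (g := fun s => f i (fun j => u (s, j))).
  set (k := fun s => f i (fun j => v (s, j))).
  replace (p i + RInt g z0 (clamp z0 h z) - (p i + RInt k z0 (clamp z0 h z)))
    with (RInt (fun s => minus (g s) (k s)) z0 (clamp z0 h z)).
  2:{ etransitivity.
      { apply (RInt_minus (V := R_CompleteNormedModule)); apply Hex; assumption. }
      unfold minus, plus, opp; simpl; ring_R. }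
  eapply Rle_trans; [apply RInt_abs_le with (M := L * C)|].
  + apply (ex_RInt_minus (V := R_CompleteNormedModule)); apply Hex; assumption.
  + intros x _; apply Hlip; [exact HC | intros j; apply Huv].
  + eapply Rle_trans;
      [apply Rmult_le_compat_l, Hz; apply Rmult_le_pos; assumption|].
    replace (L * C * h) with (C * (L * h)) by ring.
    apply Rmult_le_compat_l; assumption.
- apply Rmult_le_pos; lra.
- intros i y z; simpl; rewrite Rminus_diag, Rabs_R0.
  apply Rmult_le_pos; [exact HK | apply Rabs_pos].
- intros a; rewrite Rabs_minus_sym; apply Hclose.
  intros i y z; simpl; rewrite Rminus_diag, Rabs_R0.
  apply Rmult_le_pos; [exact HK | apply Rabs_pos].
- exists (fun z i => u (z, i)); split; [|split].
  + intros i; rewrite <- Hu; unfold picard; simpl.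
    rewrite clamp_id, RInt_point by
      (rewrite Rminus_diag, Rabs_R0; lra).
    change zero with 0; ring.
  + intros z i; rewrite <- Hu; apply (Hclose u Qu (z, i)).
  + intros z i Hzh.
    set (g := fun s => f i (fun j => u (s, j))).
    apply is_derive_ext_loc with (fun x => p i + RInt g z0 x).
    * assert (Hd : 0 < h - Rabs (z - z0)) by lra.
      exists (mkposreal _ Hd); intros y Hy.
      change (Rabs (y - z) < h - Rabs (z - z0)) in Hy.
      rewrite <- Hu; unfold picard; simpl; rewrite clamp_id; [reflexivity|].
      replace (y - z0) with ((y - z) + (z - z0)) by ring.
      eapply Rle_trans; [apply Rabs_triang | lra].
    * replace (f i (fun j => u (z, j))) with (0 + g z) by (unfold g; ring).
      apply (is_derive_plus (K := R_AbsRing) (V := R_NormedModule)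
               (fun _ => p i) (fun x => RInt g z0 x)).
      -- apply (is_derive_const (K := R_AbsRing) (V := R_NormedModule)).
      -- apply (is_derive_RInt (V := R_NormedModule)) with (a := z0).
         ++ apply filter_forall; intros y.
            apply (RInt_correct (V := R_CompleteNormedModule)), Hex, Qu.
         ++ apply Hcont, Qu.
Qed.

(** * Locally Lipschitz functions for the supremum distance *)

Definition locally_lipschitz {I : Type} (p : I -> R) (f : (I -> R) -> R) : Prop :=
  exists (d : posreal) (L : R), 0 <= L /\
  forall v w C, sup_close d v p -> sup_close d w p -> 0 <= C -> sup_close C v w ->
    Rabs (f v - f w) <= L * C.

Definition near {I : Type} (p : I -> R) (P : (I -> R) -> Prop) : Prop :=
  exists d : posreal, forall v, sup_close d v p -> P v.

Lemma sup_close_Rmin {I : Type} (p v : I -> R) a b :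
  sup_close (Rmin a b) v p -> sup_close a v p /\ sup_close b v p.
Proof.
intros Hv; split; intros i; (eapply Rle_trans; [apply Hv|]);
  [apply Rmin_l | apply Rmin_r].
Qed.

Lemma near_and {I : Type} (p : I -> R) (P Q : (I -> R) -> Prop) :
  near p P -> near p Q -> near p (fun v => P v /\ Q v).
Proof.
intros [d1 H1] [d2 H2].
assert (Hd : 0 < Rmin d1 d2) by (apply Rmin_pos; apply cond_pos).
exists (mkposreal _ Hd); intros v [Hv1 Hv2]%sup_close_Rmin; auto.
Qed.

Lemma near_imp {I : Type} (p : I -> R) (P Q : (I -> R) -> Prop) :
  (forall v, P v -> Q v) -> near p P -> near p Q.
Proof. intros HPQ [d Hd]; exists d; auto. Qed.

Lemma locally_lipschitz_near {I : Type} (p : I -> R) f (P : R -> Prop) :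
  locally_lipschitz p f -> locally (f p) P -> near p (fun v => P (f v)).
Proof.
intros (d & L & HL & Hf) [eps HP].
set (d' := Rmin d (eps / (L + 1) / 2)).
assert (He : 0 < eps / (L + 1)).
{ apply Rdiv_lt_0_compat; [apply cond_pos | lra]. }
assert (Hd' : 0 < d').
{ apply Rmin_pos; [apply cond_pos | lra]. }
exists (mkposreal _ Hd'); intros v Hv; apply HP.
change (Rabs (f v - f p) < eps).
apply Rle_lt_trans with (L * d').
- apply Hf.
  + intros i; eapply Rle_trans; [apply Hv | apply Rmin_l].
  + intros i; rewrite Rminus_diag, Rabs_R0.
    apply Rlt_le, cond_pos.
  + lra.
  + exact Hv.
- assert (H : d' < eps / (L + 1)).
  { eapply Rle_lt_trans; [apply Rmin_r | lra]. }
  apply Rlt_div_r in H; [|lra].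
  eapply Rle_lt_trans; [|exact H].
  rewrite Rmult_comm; apply Rmult_le_compat_l; lra.
Qed.

Lemma locally_lipschitz_ext {I : Type} (p : I -> R) (f g : (I -> R) -> R) :
  near p (fun v => f v = g v) -> locally_lipschitz p g -> locally_lipschitz p f.
Proof.
intros [d1 H1] (d2 & L & HL & H2).
assert (Hd : 0 < Rmin d1 d2) by (apply Rmin_pos; apply cond_pos).
exists (mkposreal _ Hd), L; split; [exact HL|]; simpl.
intros v w C [Hv1 Hv2]%sup_close_Rmin [Hw1 Hw2]%sup_close_Rmin HC Hvw.
rewrite !H1 by assumption; auto.
Qed.

Lemma locally_lipschitz_const {I : Type} (p : I -> R) (c : R) :
  locally_lipschitz p (fun _ => c).
Proof.
exists (mkposreal 1 Rlt_0_1), 0; split; [lra|]; intros.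
rewrite Rminus_diag, Rabs_R0; lra.
Qed.

Lemma locally_lipschitz_coord {I : Type} (p : I -> R) (i : I) :
  locally_lipschitz p (fun v => v i).
Proof.
exists (mkposreal 1 Rlt_0_1), 1; split; [lra|]; intros v w C _ _ _ H.
rewrite Rmult_1_l; apply H.
Qed.

Lemma locally_lipschitz_plus {I : Type} (p : I -> R) f g :
  locally_lipschitz p f -> locally_lipschitz p g ->
  locally_lipschitz p (fun v => f v + g v).
Proof.
intros (d1 & L1 & HL1 & H1) (d2 & L2 & HL2 & H2).
assert (Hd : 0 < Rmin d1 d2) by (apply Rmin_pos; apply cond_pos).
exists (mkposreal _ Hd), (L1 + L2); split; [lra|]; simpl.
intros v w C [Hv1 Hv2]%sup_close_Rmin [Hw1 Hw2]%sup_close_Rmin HC Hvw.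
specialize (H1 v w C Hv1 Hw1 HC Hvw); specialize (H2 v w C Hv2 Hw2 HC Hvw).
replace (f v + g v - (f w + g w)) with ((f v - f w) + (g v - g w)) by ring.
eapply Rle_trans; [apply Rabs_triang | lra].
Qed.

Lemma locally_lipschitz_mult {I : Type} (p : I -> R) f g :
  locally_lipschitz p f -> locally_lipschitz p g ->
  locally_lipschitz p (fun v => f v * g v).
Proof.
assert (Hbd : forall f, locally_lipschitz p f ->
          near p (fun v => Rabs (f v) <= Rabs (f p) + 1)).
{ intros k Hk; apply (locally_lipschitz_near p k (fun y => Rabs y <= Rabs (k p) + 1));
    [exact Hk|].
  exists (mkposreal 1 Rlt_0_1); intros y Hy.
  change (Rabs (y - k p) < 1) in Hy.
  replace y with (k p + (y - k p)) by ring.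
  eapply Rle_trans; [apply Rabs_triang | lra]. }
intros Hf Hg.
destruct (near_and _ _ _ (Hbd f Hf) (Hbd g Hg)) as [d0 H0].
destruct Hf as (d1 & L1 & HL1 & H1), Hg as (d2 & L2 & HL2 & H2).
assert (Hd : 0 < Rmin d0 (Rmin d1 d2)).
{ repeat apply Rmin_pos; apply cond_pos. }
pose proof (Rabs_pos (f p)); pose proof (Rabs_pos (g p)).
exists (mkposreal _ Hd), ((Rabs (f p) + 1) * L2 + (Rabs (g p) + 1) * L1).
split; [apply Rplus_le_le_0_compat; apply Rmult_le_pos; lra|]; simpl.
intros v w C [Hv0 [Hv1 Hv2]%sup_close_Rmin]%sup_close_Rmin
  [Hw0 [Hw1 Hw2]%sup_close_Rmin]%sup_close_Rmin HC Hvw.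
replace (f v * g v - f w * g w)
  with (f v * (g v - g w) + (f v - f w) * g w) by ring.
eapply Rle_trans; [apply Rabs_triang|].
rewrite !Rabs_mult, Rmult_plus_distr_r.
replace ((Rabs (g p) + 1) * L1 * C) with (L1 * C * (Rabs (g p) + 1)) by ring.
rewrite Rmult_assoc.
apply Rplus_le_compat; apply Rmult_le_compat; try apply Rabs_pos; auto.
- apply H0; assumption.
- apply H0; assumption.
Qed.

Lemma locally_lipschitz_opp {I : Type} (p : I -> R) f :
  locally_lipschitz p f -> locally_lipschitz p (fun v => - f v).
Proof.
intros Hf; apply locally_lipschitz_ext with (fun v => -1 * f v).
- exists (mkposreal 1 Rlt_0_1); intros; ring.
- apply locally_lipschitz_mult; [apply locally_lipschitz_const | exact Hf].
Qed.

Lemma locally_lipschitz_minus {I : Type} (p : I -> R) f g :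
  locally_lipschitz p f -> locally_lipschitz p g ->
  locally_lipschitz p (fun v => f v - g v).
Proof.
intros; apply locally_lipschitz_plus;
  [assumption | apply locally_lipschitz_opp; assumption].
Qed.

Lemma lipschitz_of_C1 (phi phi' : R -> R) (a b : R) :
  (forall x, a <= x <= b -> is_derive phi x (phi' x)) ->
  (forall x, a <= x <= b -> continuous phi' x) ->
  exists L, 0 <= L /\ forall x y, a <= x <= b -> a <= y <= b ->
    Rabs (phi x - phi y) <= L * Rabs (x - y).
Proof.
intros Hd Hc.
destruct (bounded_continuity phi' a b Hc) as [M HM].
exists (Rmax 0 M); split; [apply Rmax_l|]; intros x y Hx Hy.
assert (Hin : forall t, Rmin y x <= t <= Rmax y x -> a <= t <= b).
{ intros t Ht; unfold Rmin, Rmax in Ht; destruct Rle_dec; lra. }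
destruct (MVT_gen phi y x phi') as (c & Hc' & ->).
- intros t Ht; apply Hd, Hin; lra.
- intros t Ht; apply derivable_continuous_pt.
  exists (phi' t); apply is_derive_Reals, Hd, Hin, Ht.
- rewrite Rabs_mult; apply Rmult_le_compat_r; [apply Rabs_pos|].
  eapply Rle_trans; [|apply Rmax_r].
  apply Rlt_le, (HM c), Hin, Hc'.
Qed.

(** A function that is twice differentiable has a continuous, hence locally
    bounded, derivative. *)
Lemma locally_lipschitz_comp {I : Type} (p : I -> R) (phi : R -> R) f :
  locally_lipschitz p f ->
  locally (f p) (fun x => ex_derive phi x /\ ex_derive (Derive phi) x) ->
  locally_lipschitz p (fun v => phi (f v)).
Proof.
intros Hf [e He].
destruct (lipschitz_of_C1 phi (Derive phi) (f p - e / 2) (f p + e / 2))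
  as (L2 & HL2 & Hphi).
1, 2: intros x Hx; assert (Hb : ball (f p) e x) by
  (pose proof (cond_pos e); apply Rabs_lt_between'; lra).
- apply Derive_correct, He, Hb.
- apply (ex_derive_continuous (K := R_AbsRing) (V := R_NormedModule)).
  apply He, Hb.
- destruct (locally_lipschitz_near p f
              (fun y => f p - e / 2 <= y <= f p + e / 2)) as [d0 H0].
  + exact Hf.
  + exists (pos_div_2 e); intros y Hy; apply Rabs_lt_between' in Hy.
    simpl in Hy; lra.
  + destruct Hf as (d1 & L1 & HL1 & H1).
    assert (Hd : 0 < Rmin d0 d1) by (apply Rmin_pos; apply cond_pos).
    exists (mkposreal _ Hd), (L2 * L1); split;
      [apply Rmult_le_pos; assumption|]; simpl.
    intros v w C [Hv0 Hv1]%sup_close_Rmin [Hw0 Hw1]%sup_close_Rmin HC Hvw.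
    eapply Rle_trans; [apply Hphi; apply H0; assumption|].
    rewrite Rmult_assoc; apply Rmult_le_compat_l; auto.
Qed.

Lemma locally_lipschitz_inv {I : Type} (p : I -> R) f :
  locally_lipschitz p f -> f p <> 0 -> locally_lipschitz p (fun v => / f v).
Proof.
intros Hf Hp; apply (locally_lipschitz_comp p Rinv f Hf).
assert (Hne : forall x, x <> 0 -> ex_derive Rinv x) by
  (intros; auto_derive; trivial).
assert (Hnear : locally (f p) (fun x => x <> 0)).
{ apply (open_neq 0), Hp. }
assert (HD : forall x, x <> 0 -> Derive Rinv x = - / x ^ 2).
{ intros x Hx; apply is_derive_unique; auto_derive; [exact Hx | field; exact Hx]. }
apply (filter_imp (fun x => x <> 0)); [|exact Hnear].
intros x Hx; split; [auto|].
apply ex_derive_ext_loc with (fun x => - / x ^ 2).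
- apply (filter_imp (fun x => x <> 0)); [|apply (open_neq 0), Hx].
  intros y Hy; symmetry; auto.
- auto_derive; simpl; repeat split; try rewrite Rmult_1_r; 
  auto using Rmult_integral_contrapositive_currified.
Qed.

Lemma locally_lipschitz_div {I : Type} (p : I -> R) f g :
  locally_lipschitz p f -> locally_lipschitz p g -> g p <> 0 ->
  locally_lipschitz p (fun v => f v / g v).
Proof.
intros; apply locally_lipschitz_mult;
  [assumption | apply locally_lipschitz_inv; assumption].
Qed.

Lemma locally_lipschitz_sqrt {I : Type} (p : I -> R) f :
  locally_lipschitz p f -> 0 < f p -> locally_lipschitz p (fun v => sqrt (f v)).
Proof.
intros Hf Hp; apply (locally_lipschitz_comp p sqrt f Hf).
assert (HD : forall x, 0 < x -> Derive sqrt x = / (2 * sqrt x)).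
{ intros x Hx; apply is_derive_unique; auto_derive; [exact Hx|].
  field; apply Rgt_not_eq, sqrt_lt_R0, Hx. }
apply (filter_imp (fun x => 0 < x)); [|apply (open_gt 0), Hp].
intros x Hx; split; [auto_derive; exact Hx|].
apply ex_derive_ext_loc with (fun x => / (2 * sqrt x)).
- apply (filter_imp (fun x => 0 < x)); [|apply (open_gt 0), Hx].
  intros y Hy; symmetry; auto.
- auto_derive; repeat split; auto.
  apply Rmult_integral_contrapositive_currified; [lra|].
  apply Rgt_not_eq, sqrt_lt_R0, Hx.
Qed.

(** The variation of the integral splits into the two pieces swept by the
    bounds, controlled by the bound [K] of the integrand, and the variation of
    the integrand over a segment of length at most [hi - lo]. *)
Lemma locally_lipschitz_RInt {I : Type} (p : I -> R) (k : R -> (I -> R) -> R)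
    (a b : (I -> R) -> R) (lo hi K L : R) (d : posreal) :
  locally_lipschitz p a -> locally_lipschitz p b ->
  lo < a p < hi -> lo < b p < hi -> 0 <= K -> 0 <= L ->
  (forall v tau, sup_close d v p -> lo <= tau <= hi ->
    continuous (fun s => k s v) tau /\ Rabs (k tau v) <= K) ->
  (forall v w C tau, sup_close d v p -> sup_close d w p -> 0 <= C ->
    sup_close C v w -> lo <= tau <= hi -> Rabs (k tau v - k tau w) <= L * C) ->
  locally_lipschitz p (fun v => RInt (fun tau => k tau v) (a v) (b v)).
Proof.
intros Ha Hb Hap Hbp HK HL Hk Hlip.
assert (Hin : forall c, locally_lipschitz p c -> lo < c p < hi ->
          near p (fun v => lo <= c v <= hi)).
{ intros c Hc Hcp; apply (locally_lipschitz_near p c (fun x => lo <= x <= hi) Hc).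
  apply (filter_imp (fun x => lo < x /\ x < hi)); [intros; lra|].
  apply filter_and; [apply (open_gt lo) | apply (open_lt hi)]; apply Hcp. }
destruct (near_and _ _ _ (Hin a Ha Hap) (Hin b Hb Hbp)) as [d0 H0].
destruct Ha as (d1 & L1 & HL1 & H1), Hb as (d2 & L2 & HL2 & H2).
assert (Hd : 0 < Rmin (Rmin d d0) (Rmin d1 d2)).
{ repeat apply Rmin_pos; apply cond_pos. }
assert (Hlh : 0 < hi - lo) by lra.
exists (mkposreal _ Hd), (K * L1 + K * L2 + L * (hi - lo)); split.
{ repeat apply Rplus_le_le_0_compat; apply Rmult_le_pos; lra. }
simpl.
intros v w C [[Hv Hv0]%sup_close_Rmin [Hv1 Hv2]%sup_close_Rmin]%sup_close_Rmin
  [[Hw Hw0]%sup_close_Rmin [Hw1 Hw2]%sup_close_Rmin]%sup_close_Rmin HC Hvw.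
destruct (H0 v Hv0) as [Hav Hbv], (H0 w Hw0) as [Haw Hbw].
specialize (H1 v w C Hv1 Hw1 HC Hvw); specialize (H2 v w C Hv2 Hw2 HC Hvw).
assert (Hseg : forall x y, lo <= x <= hi -> lo <= y <= hi ->
          forall t, Rmin x y <= t <= Rmax x y -> lo <= t <= hi).
{ intros x y Hx Hy t; unfold Rmin, Rmax; destruct Rle_dec; lra. }
assert (Hex : forall u x y, sup_close d u p -> lo <= x <= hi -> lo <= y <= hi ->
          ex_RInt (fun tau => k tau u) x y).
{ intros u x y Hu Hx Hy; apply (ex_RInt_continuous (V := R_CompleteNormedModule)).
  intros t Ht; apply Hk; [exact Hu | apply (Hseg x y); assumption]. }
assert (HKb : forall u x y, sup_close d u p -> lo <= x <= hi -> lo <= y <= hi ->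
          Rabs (RInt (fun tau => k tau u) x y) <= K * Rabs (y - x)).
{ intros u x y Hu Hx Hy; apply RInt_abs_le; [auto|].
  intros t Ht; apply Hk; [exact Hu | apply (Hseg x y); assumption]. }
assert (HC1 := RInt_Chasles (V := R_CompleteNormedModule) (fun tau => k tau v)
                (a v) (a w) (b v) (Hex _ _ _ Hv Hav Haw) (Hex _ _ _ Hv Haw Hbv)).
assert (HC2 := RInt_Chasles (V := R_CompleteNormedModule) (fun tau => k tau v)
                (a w) (b w) (b v) (Hex _ _ _ Hv Haw Hbw) (Hex _ _ _ Hv Hbw Hbv)).
assert (HM := RInt_minus (V := R_CompleteNormedModule) (fun tau => k tau v)
                (fun tau => k tau w)
                (a w) (b w) (Hex _ _ _ Hv Haw Hbw) (Hex _ _ _ Hw Haw Hbw)).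
assert (HLb : Rabs (RInt (fun tau => k tau v) (a w) (b w)
                    - RInt (fun tau => k tau w) (a w) (b w))
          <= L * C * Rabs (b w - a w)).
{ refine (eq_ind _ (fun x : R => Rabs x <= _) _ _ HM); apply RInt_abs_le.
  - apply (ex_RInt_minus (V := R_CompleteNormedModule)); apply Hex; assumption.
  - intros t Ht; apply Hlip; try assumption.
    apply (Hseg (a w) (b w)); assumption. }
assert (HB1 := HKb v (a v) (a w) Hv Hav Haw).
assert (HB2 := HKb v (b w) (b v) Hv Hbw Hbv).
refine (eq_ind _ (fun x : R => Rabs (x - _) <= _) _ _ HC1).
refine (eq_ind _ (fun x : R => Rabs (_ + x - _) <= _) _ _ HC2).
set (i1 := RInt _ (a v) (a w) : R) in *.
set (i2 := RInt (fun tau => k tau v) (a w) (b w) : R) in *.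
set (i3 := RInt _ (b w) (b v) : R) in *.
set (i4 := RInt (fun tau => k tau w) (a w) (b w) : R) in *.
change (Rabs (i1 + (i2 + i3) - i4) <= (K * L1 + K * L2 + L * (hi - lo)) * C).
replace (i1 + (i2 + i3) - i4) with (i1 + (i3 + (i2 - i4))) by ring_R.
eapply Rle_trans; [apply Rabs_triang|].
eapply Rle_trans; [apply Rplus_le_compat_l, Rabs_triang|].
rewrite (Rabs_minus_sym (a w)) in HB1.
assert (K * Rabs (a v - a w) <= K * (L1 * C)) by
  (apply Rmult_le_compat_l; assumption).
assert (K * Rabs (b v - b w) <= K * (L2 * C)) by
  (apply Rmult_le_compat_l; assumption).
assert (L * C * Rabs (b w - a w) <= L * C * (hi - lo)).
{ apply Rmult_le_compat_l; [apply Rmult_le_pos; assumption|].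
  apply Rabs_le_between; lra. }
lra.
Qed.

(** * The Picard-Lindelof theorem for a locally Lipschitz field *)

(** The least upper bound of the radii [s <= h] of the balls on which [P] holds
    is itself such a radius, and the hypothesis forces it to be [h]. *)
Lemma ball_induction (P : R -> Prop) (z0 h : R) :
  0 < h ->
  (forall s, 0 <= s < h -> (forall u, Rabs (u - z0) < s -> P u) ->
    exists e, 0 < e /\ forall u, Rabs (u - z0) < s + e -> P u) ->
  forall u, Rabs (u - z0) < h -> P u.
Proof.
intros Hh Hstep.
set (S := fun s => 0 <= s <= h /\ forall u, Rabs (u - z0) < s -> P u).
destruct (completeness S) as [m [Hub Hlub]].
- exists h; intros s Hs; apply Hs.
- exists 0; split; [lra|]; intros u Hu; pose proof (Rabs_pos (u - z0)); lra.
- assert (Hm : forall u, Rabs (u - z0) < m -> P u).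
  { intros u Hu; destruct (Classical_Prop.classic (P u)) as [|Hn]; [assumption|].
    exfalso; apply (Rlt_not_le _ _ Hu), Hlub; intros s [_ Hs].
    apply Rnot_lt_le; intros Hlt; apply Hn, Hs, Hlt. }
  assert (Hm0 : 0 <= m).
  { apply Hub; split; [lra|]; intros u Hu; pose proof (Rabs_pos (u - z0)); lra. }
  assert (Hmh : m <= h) by (apply Hlub; intros s Hs; apply Hs).
  destruct (Req_dec m h) as [<-|Hne]; [exact Hm|].
  destruct (Hstep m) as (e & He & Hext); [lra | exact Hm |].
  exfalso; assert (H : S (Rmin (m + e) h)).
  { split; [split; [apply Rmin_glb; lra | apply Rmin_r]|].
    intros u Hu; apply Hext; eapply Rlt_le_trans; [exact Hu | apply Rmin_l]. }
  apply Hub in H; unfold Rmin in H; destruct Rle_dec; lra.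
Qed.

(** Assuming the bound on the derivative in the open interval only is what lets
    a solution be estimated on a closed ball when it is controlled in the
    interior. *)
Lemma Rabs_increment_le (u u' : R -> R) (K a b : R) :
  (forall t, Rabs (t - a) <= Rabs (b - a) -> is_derive u t (u' t)) ->
  (forall t, Rabs (t - a) < Rabs (b - a) -> Rabs (u' t) <= K) ->
  Rabs (u b - u a) <= K * Rabs (b - a).
Proof.
intros Hd HK.
destruct (Rtotal_order a b) as [Hab|[<-|Hab]].
- destruct (MVT_cor2 u u' a b Hab) as (c & -> & Hc).
  + intros c Hc; apply is_derive_Reals, Hd; rewrite !Rabs_pos_eq; lra.
  + rewrite Rabs_mult; apply Rmult_le_compat_r; [apply Rabs_pos|].
    apply HK; rewrite !Rabs_pos_eq; lra.
- rewrite !Rminus_diag, Rabs_R0; lra.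
- destruct (MVT_cor2 u u' b a Hab) as (c & Heq & Hc).
  + intros c Hc; apply is_derive_Reals, Hd; rewrite !Rabs_left1; lra.
  + rewrite Rabs_minus_sym, Heq, (Rabs_minus_sym b a), Rabs_mult.
    apply Rmult_le_compat_r; [apply Rabs_pos|].
    apply HK; rewrite !Rabs_left1; lra.
Qed.

Lemma finite_locally_lipschitz (I : Type) (l : list I) (f : I -> (I -> R) -> R)
    (p : I -> R) :
  (forall i, locally_lipschitz p (f i)) ->
  exists (d : posreal) (L K : R), 0 <= L /\ 0 <= K /\ forall i, In i l ->
    (forall v, sup_close d v p -> Rabs (f i v) <= K) /\
    (forall v w C, sup_close d v p -> sup_close d w p -> 0 <= C ->
      sup_close C v w -> Rabs (f i v - f i w) <= L * C).
Proof.
intros Hf; induction l as [|i l IH].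
- exists (mkposreal 1 Rlt_0_1), 0, 0; repeat split; try lra; contradiction.
- destruct IH as (d1 & L1 & K1 & HL1 & HK1 & H1).
  destruct (Hf i) as (d2 & L2 & HL2 & H2).
  assert (Hd : 0 < Rmin d1 d2) by (apply Rmin_pos; apply cond_pos).
  exists (mkposreal _ Hd), (Rmax L1 L2), (Rmax K1 (Rabs (f i p) + L2 * d2)).
  split; [eapply Rle_trans; [exact HL1 | apply Rmax_l]|].
  split; [eapply Rle_trans; [exact HK1 | apply Rmax_l]|]; simpl.
  intros j [<-|Hj]; split.
  + intros v [_ Hv]%sup_close_Rmin.
    eapply Rle_trans; [|apply Rmax_r].
    replace (f i v) with (f i p + (f i v - f i p)) by ring.
    eapply Rle_trans; [apply Rabs_triang|]; apply Rplus_le_compat_l.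
    pose proof (cond_pos d2).
    apply H2; [exact Hv | | lra | exact Hv].
    intros j; rewrite Rminus_diag, Rabs_R0; lra.
  + intros v w C [_ Hv]%sup_close_Rmin [_ Hw]%sup_close_Rmin HC Hvw.
    eapply Rle_trans; [apply (H2 v w C); assumption|].
    apply Rmult_le_compat_r; [exact HC | apply Rmax_r].
  + intros v [Hv _]%sup_close_Rmin.
    eapply Rle_trans; [apply H1; assumption | apply Rmax_l].
  + intros v w C [Hv _]%sup_close_Rmin [Hw _]%sup_close_Rmin HC Hvw.
    eapply Rle_trans; [apply (proj2 (H1 j Hj) v w C); assumption|].
    apply Rmult_le_compat_r; [exact HC | apply Rmax_l].
Qed.

Lemma locally_all_in {I : Type} (l : list I) (z : R) (P : I -> R -> Prop) :
  (forall i, locally z (P i)) -> locally z (fun x => forall i, In i l -> P i x).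
Proof.
intros HP; induction l as [|i l IH].
- apply filter_forall; contradiction.
- refine (filter_imp _ _ _ (filter_and _ _ (HP i) IH)).
  intros x [Hi Hl] j [<-|Hj]; auto.
Qed.

(** A solution cannot leave the box of radius [d] in a time [h] with
    [K * h < d]: as long as it stays there its speed is at most [K], so at
    distance [s] from the initial time it is at distance at most [K * s < d]
    from [p], and by continuity it stays in the box a little longer.  This makes
    uniqueness hold among all solutions, without any assumption on where they
    take their values. *)
Lemma solution_confined (I : Type) (l : list I) (f : I -> (I -> R) -> R)
    (p : I -> R) (z0 h d K : R) (Y : R -> I -> R) :
  (forall i, In i l) -> 0 < h -> 0 <= K -> K * h < d ->
  (forall i v, sup_close d v p -> Rabs (f i v) <= K) ->
  (forall i, Y z0 i = p i) ->
  (forall z i, Rabs (z - z0) < h -> is_derive (fun s => Y s i) z (f i (Y z))) ->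
  forall z, Rabs (z - z0) < h -> sup_close d (Y z) p.
Proof.
intros Hl Hh HK HKh Hbd HY0 HY.
apply ball_induction; [exact Hh|]; intros s Hs Hin.
assert (HKs : K * s < d).
{ eapply Rle_lt_trans; [|exact HKh]; apply Rmult_le_compat_l; lra. }
(* At distance exactly s the mean value theorem still gives a bound below d, which
   leaves room to extend by continuity. *)
assert (Hedge : forall u, Rabs (u - z0) = s ->
          locally u (fun x => sup_close d (Y x) p)).
{ intros u Hu.
  apply (filter_imp (fun x => forall i, In i l -> Rabs (Y x i - p i) <= d));
    [intros x Hx i; apply Hx, Hl|].
  apply (locally_all_in l u (fun i x => Rabs (Y x i - p i) <= d)); intros i.
  assert (Hui : Rabs (Y u i - p i) < d).
  { eapply Rle_lt_trans; [|exact HKs].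
    rewrite <- HY0, <- Hu.
    apply (Rabs_increment_le (fun x => Y x i) (fun x => f i (Y x))).
    - intros t Ht; apply HY; lra.
    - intros t Ht; apply Hbd, Hin; lra. }
  assert (Hc : continuous (fun x => Y x i) u).
  { apply (ex_derive_continuous (K := R_AbsRing) (V := R_NormedModule)).
    eexists; apply HY; lra. }
  apply (Hc (fun x => Rabs (x - p i) <= d)).
  apply Rabs_lt_between' in Hui.
  apply (filter_imp (fun x => p i - d < x /\ x < p i + d)).
  - intros x Hx; apply Rlt_le, Rabs_lt_between', Hx.
  - apply filter_and; [apply (open_gt (p i - d)) | apply (open_lt (p i + d))];
      apply Hui. }
destruct (Hedge (z0 + s)) as [e1 He1].
{ replace (z0 + s - z0) with s by ring; apply Rabs_pos_eq; lra. }
destruct (Hedge (z0 - s)) as [e2 He2].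
{ replace (z0 - s - z0) with (- s) by ring; rewrite Rabs_Ropp.
  apply Rabs_pos_eq; lra. }
exists (Rmin e1 e2); split; [apply Rmin_pos; apply cond_pos|].
intros u Hu.
pose proof (Rmin_l e1 e2); pose proof (Rmin_r e1 e2).
destruct (Rlt_dec (Rabs (u - z0)) s) as [Hlt|Hge]; [apply Hin, Hlt|].
apply Rabs_lt_between' in Hu.
assert (Hor : s <= u - z0 \/ u - z0 <= - s).
{ unfold Rabs in Hge; destruct Rcase_abs in Hge; lra. }
destruct Hor.
- apply He1; apply Rabs_lt_between'; lra.
- apply He2; apply Rabs_lt_between'; lra.
Qed.

(** The distance between the two solutions is halved by each application of the
    mean value theorem, since it is bounded by its own bound times
    [L * h <= 1 / 2]. *)
Lemma solutions_agree (I : Type) (f : I -> (I -> R) -> R)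
    (p : I -> R) (z0 h d L : R) (X Y : R -> I -> R) :
  0 <= d -> 0 <= L -> L * h <= / 2 ->
  (forall i v w C, sup_close d v p -> sup_close d w p -> 0 <= C ->
    sup_close C v w -> Rabs (f i v - f i w) <= L * C) ->
  (forall i, X z0 i = p i) -> (forall i, Y z0 i = p i) ->
  (forall z, Rabs (z - z0) < h -> sup_close d (X z) p) ->
  (forall z, Rabs (z - z0) < h -> sup_close d (Y z) p) ->
  (forall z i, Rabs (z - z0) < h -> is_derive (fun s => X s i) z (f i (X z))) ->
  (forall z i, Rabs (z - z0) < h -> is_derive (fun s => Y s i) z (f i (Y z))) ->
  forall z i, Rabs (z - z0) < h -> Y z i = X z i.
Proof.
intros Hd HL HLh Hlip HX0 HY0 HXd HYd HX HY z i Hz.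
enough (H : forall (n : nat) z, Rabs (z - z0) < h ->
          sup_close (2 * d * (/ 2) ^ n) (Y z) (X z)).
{ apply Rminus_diag_uniq, (Rabs_le_half_pow_eq_0 _ (2 * d)).
  intros n; apply H, Hz. }
clear z i Hz; induction n as [|n IHn]; intros z Hz i.
- simpl; replace (Y z i - X z i) with ((Y z i - p i) - (X z i - p i)) by ring.
  eapply Rle_trans; [apply Rabs_triang|]; rewrite Rabs_Ropp.
  pose proof (HXd z Hz i); pose proof (HYd z Hz i); lra.
- set (C := 2 * d * (/ 2) ^ n) in *.
  assert (HC : 0 <= C).
  { apply Rmult_le_pos; [lra | apply pow_le; lra]. }
  replace (2 * d * (/ 2) ^ S n) with (C * / 2) by (unfold C; simpl; ring).
  replace (Y z i - X z i)
    with ((Y z i - X z i) - (Y z0 i - X z0 i)) by (rewrite HX0, HY0; ring).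
  eapply Rle_trans.
  + apply (Rabs_increment_le (fun x => Y x i - X x i)
             (fun x => f i (Y x) - f i (X x)) (L * C)).
    * intros t Ht.
      apply (is_derive_minus (K := R_AbsRing) (V := R_NormedModule)
               (fun x => Y x i) (fun x => X x i)); [apply HY | apply HX]; lra.
    * intros t Ht; apply Hlip; [apply HYd | apply HXd | exact HC | apply IHn]; lra.
  + replace (L * C * Rabs (z - z0)) with (C * (L * Rabs (z - z0))) by ring.
    apply Rmult_le_compat_l; [exact HC|].
    eapply Rle_trans; [apply Rmult_le_compat_l; [exact HL | apply Rlt_le, Hz]|].
    exact HLh.
Qed.

(** The field is replaced by its composition with the projection onto a box
    around [p], which is globally bounded and Lipschitz.  The time [h] is so
    short that solutions do not leave the box, where both fields agree. *)
Theorem picard_lindelof (I : Type) (l : list I) (f : I -> (I -> R) -> R)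
    (p : I -> R) (z0 : R) (P : (I -> R) -> Prop) :
  (forall i, In i l) ->
  (forall i, locally_lipschitz p (f i)) -> near p P ->
  exists (h : R) (X : R -> I -> R), 0 < h /\ (forall i, X z0 i = p i) /\
    (forall z, Rabs (z - z0) < h ->
      P (X z) /\ forall i, is_derive (fun s => X s i) z (f i (X z))) /\
    (forall Y : R -> I -> R, (forall i, Y z0 i = p i) ->
      (forall z i, Rabs (z - z0) < h ->
        is_derive (fun s => Y s i) z (f i (Y z))) ->
      forall z i, Rabs (z - z0) < h -> Y z i = X z i).
Proof.
intros Hl Hf [d0 HP].
destruct (finite_locally_lipschitz I l f p Hf)
  as (d1 & L & K & HL & HK & Hfam).
set (d := Rmin d0 d1).
assert (Hd : 0 < d) by (apply Rmin_pos; apply cond_pos).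
assert (Hd0 : forall v, sup_close d v p -> sup_close d0 v p).
{ intros v Hv; apply (sup_close_Rmin p v d0 d1), Hv. }
assert (Hd1 : forall v, sup_close d v p -> sup_close d1 v p).
{ intros v Hv; apply (sup_close_Rmin p v d0 d1), Hv. }
assert (Hbd : forall i v, sup_close d v p -> Rabs (f i v) <= K).
{ intros i v Hv; apply Hfam; auto. }
assert (Hlip : forall i v w C, sup_close d v p -> sup_close d w p -> 0 <= C ->
          sup_close C v w -> Rabs (f i v - f i w) <= L * C).
{ intros i v w C Hv Hw; apply Hfam; auto. }
set (box := fun (v : I -> R) j => clamp (p j) d (v j)).
assert (Hbox : forall v, sup_close d (box v) p).
{ intros v j; apply clamp_near; lra. }
set (h := Rmin (/ (2 * (L + 1))) (d / (2 * (K + 1)))).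
assert (Hh : 0 < h).
{ apply Rmin_pos; [apply Rinv_0_lt_compat | apply Rdiv_lt_0_compat]; lra. }
assert (HLh : L * h <= / 2).
{ apply Rle_trans with (L * / (2 * (L + 1))).
  - apply Rmult_le_compat_l; [exact HL | apply Rmin_l].
  - apply Rmult_le_reg_r with (2 * (L + 1)); [lra|]; field_simplify; lra. }
assert (HKh : K * h < d).
{ apply Rle_lt_trans with (K * (d / (2 * (K + 1)))).
  - apply Rmult_le_compat_l; [exact HK | apply Rmin_r].
  - apply Rmult_lt_reg_r with (2 * (K + 1)); [lra|]; field_simplify; nra. }
destruct (picard_solution I (fun i v => f i (box v)) p z0 h K L)
  as (X & HX0 & HXK & HX); try assumption.
- intros i v; apply Hbd, Hbox.
- intros v w C HC Hvw i; apply Hlip; try apply Hbox; [exact HC|].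
  intros j; eapply Rle_trans; [apply clamp_lipschitz | apply Hvw].
- assert (HXd : forall z, sup_close d (X z) p).
  { intros z i; eapply Rle_trans; [apply HXK | lra]. }
  assert (HX' : forall z i, Rabs (z - z0) < h ->
            is_derive (fun s => X s i) z (f i (X z))).
  { intros z i Hz; replace (f i (X z)) with (f i (box (X z))); [apply HX, Hz|].
    apply Rminus_diag_uniq, Rabs_eq_0, Rle_antisym; [|apply Rabs_pos].
    replace 0 with (L * 0) by ring; apply Hlip; auto; [lra|].
    intros j; unfold box; rewrite clamp_id by apply HXd.
    rewrite Rminus_diag, Rabs_R0; lra. }
  exists h, X; split; [exact Hh|]; split; [exact HX0|]; split.
  { intros z Hz; split; [apply HP, Hd0, HXd | intros i; apply HX', Hz]. }
  intros Y HY0 HY; apply (solutions_agree I f p z0 h d L); auto; [lra|].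
  apply (solution_confined I l f p z0 h d K); assumption.
Qed.

(** * The partial derivatives of J *)

(** Up to the factor [- tau / 2], respectively [- 1 / 2], this is the derivative
    of [sqrt (tau / (tau * e + m))] in [e], respectively in [m]. *)
Definition weight (tau e m : R) : R := sqrt (tau / (tau * e + m)) / (tau * e + m).

(** The derivatives of [J] in [m] and in [e] are [sigma / 2] times the zeroth
    and the first moment of [weight]; the affine factor treats them together. *)
Definition moment (alpha beta a b e m : R) : R :=
  RInt (fun tau => (alpha * tau + beta) * weight tau e m) a b.

Lemma seg_pos (a b t : R) : 0 < a -> 0 < b -> Rmin a b <= t <= Rmax a b -> 0 < t.
Proof. intros; unfold Rmin, Rmax in *; destruct Rle_dec; lra. Qed.

Lemma affine_pos (tau e m : R) : 0 <= tau -> 0 < e -> 0 < m -> 0 < tau * e + m.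
Proof. intros; nra. Qed.

Lemma continuous_ratio (tau e m : R) :
  0 < tau * e + m -> continuous (fun s => s / (s * e + m)) tau.
Proof.
intros Hq; apply (ex_derive_continuous (K := R_AbsRing) (V := R_NormedModule)).
auto_derive; lra.
Qed.

Lemma continuous_integrand (tau e m : R) :
  0 < tau * e + m -> continuous (fun s => sqrt (s / (s * e + m))) tau.
Proof. intros Hq; apply continuous_sqrt_comp, continuous_ratio, Hq. Qed.

Lemma continuous_weighted (alpha beta tau e m : R) :
  0 < tau * e + m ->
  continuous (fun s => (alpha * s + beta) * weight s e m) tau.
Proof.
intros Hq.
apply (continuous_mult (K := R_AbsRing) (fun s => alpha * s + beta)).
- apply (ex_derive_continuous (K := R_AbsRing) (V := R_NormedModule)).
  auto_derive; trivial.
- apply (continuous_mult (K := R_AbsRing) (fun s => sqrt (s / (s * e + m)))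
          (fun s => / (s * e + m))).
  + apply continuous_integrand, Hq.
  + apply (ex_derive_continuous (K := R_AbsRing) (V := R_NormedModule)).
    auto_derive; lra.
Qed.

Lemma ex_RInt_integrand (a b e m : R) :
  0 < a -> 0 < b -> 0 < e -> 0 < m ->
  ex_RInt (fun s => sqrt (s / (s * e + m))) a b.
Proof.
intros Ha Hb He Hm; apply (ex_RInt_continuous (V := R_CompleteNormedModule)).
intros t Ht%seg_pos; try assumption.
apply continuous_integrand, affine_pos; lra.
Qed.

Lemma ex_RInt_weighted (alpha beta a b e m : R) :
  0 < a -> 0 < b -> 0 < e -> 0 < m ->
  ex_RInt (fun s => (alpha * s + beta) * weight s e m) a b.
Proof.
intros Ha Hb He Hm; apply (ex_RInt_continuous (V := R_CompleteNormedModule)).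
intros t Ht%seg_pos; try assumption.
apply continuous_weighted, affine_pos; lra.
Qed.

(** The parameters move along a line with direction [(alpha, beta)], so that
    differentiation in [e] and in [m] are two instances. *)
Lemma is_derive_integrand_param (tau e0 m0 alpha beta u : R) :
  0 < tau -> 0 < e0 + alpha * u -> 0 < m0 + beta * u ->
  is_derive (fun x => sqrt (tau / (tau * (e0 + alpha * x) + (m0 + beta * x)))) u
    (- / 2 * ((alpha * tau + beta) * weight tau (e0 + alpha * u) (m0 + beta * u))).
Proof.
intros Ht He Hm; unfold weight.
set (q := tau * (e0 + alpha * u) + (m0 + beta * u)).
assert (Hq : 0 < q) by (apply affine_pos; lra).
assert (Hs : 0 < tau / q) by (apply Rdiv_lt_0_compat; assumption).
auto_derive; fold q.
- split; [lra | split; [exact Hs | trivial]].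
- assert (Hss := sqrt_sqrt (tau / q) (Rlt_le _ _ Hs)).
  assert (Hsp := sqrt_lt_R0 _ Hs).
  set (s := sqrt (tau / q)) in *.
  (* Eliminating tau in favour of the square root s leaves a rational identity. *)
  assert (Htau : tau = s * s * q) by (rewrite Hss; field; lra).
  change (sqrt (tau * / q)) with s.
  clearbody s q; subst tau; field; split; lra.
Qed.

Lemma continuity_2d_weighted (tau e0 m0 alpha beta u : R) :
  0 < tau -> 0 < e0 + alpha * u -> 0 < m0 + beta * u ->
  continuity_2d_pt (fun x t => - / 2 *
    ((alpha * t + beta) * weight t (e0 + alpha * x) (m0 + beta * x))) u tau.
Proof.
intros Ht He Hm.
assert (Hq : 0 < tau * (e0 + alpha * u) + (m0 + beta * u))
  by (apply affine_pos; lra).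
assert (Hcq : continuity_2d_pt
          (fun x t => / (t * (e0 + alpha * x) + (m0 + beta * x))) u tau).
{ apply continuity_2d_pt_inv; [|lra].
  repeat first [apply continuity_2d_pt_plus | apply continuity_2d_pt_mult
    | apply continuity_2d_pt_id1 | apply continuity_2d_pt_id2
    | apply continuity_2d_pt_const]. }
unfold weight, Rdiv.
apply continuity_2d_pt_mult; [apply continuity_2d_pt_const|].
apply continuity_2d_pt_mult.
- repeat first [apply continuity_2d_pt_plus | apply continuity_2d_pt_mult
    | apply continuity_2d_pt_id2 | apply continuity_2d_pt_const].
- apply continuity_2d_pt_mult; [|exact Hcq].
  apply continuity_1d_2d_pt_comp.
  + apply continuity_pt_filterlim, continuous_sqrt.
  + apply continuity_2d_pt_mult; [apply continuity_2d_pt_id2 | exact Hcq].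
Qed.

Lemma is_derive_RInt_integrand (a b e0 m0 alpha beta x : R) :
  0 < a -> 0 < b -> 0 < e0 + alpha * x -> 0 < m0 + beta * x ->
  is_derive (fun u => RInt
      (fun tau => sqrt (tau / (tau * (e0 + alpha * u) + (m0 + beta * u)))) a b) x
    (- / 2 * moment alpha beta a b (e0 + alpha * x) (m0 + beta * x)).
Proof.
intros Ha Hb He Hm.
assert (Hpos : locally x (fun u => 0 < e0 + alpha * u /\ 0 < m0 + beta * u)).
{ assert (Hc : forall c0 c, continuous (fun u => c0 + c * u) x).
  { intros c0 c.
    apply (ex_derive_continuous (K := R_AbsRing) (V := R_NormedModule)).
    auto_derive; trivial. }
  apply filter_and; [apply (Hc e0 alpha) | apply (Hc m0 beta)];
    apply (open_gt 0); assumption. }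
replace (- / 2 * moment alpha beta a b (e0 + alpha * x) (m0 + beta * x))
  with (RInt (fun t => Derive (fun u =>
          sqrt (t / (t * (e0 + alpha * u) + (m0 + beta * u)))) x) a b).
- apply (is_derive_RInt_param (fun u tau =>
    sqrt (tau / (tau * (e0 + alpha * u) + (m0 + beta * u))))).
  + apply (filter_imp _ _) with (2 := Hpos); intros u [Heu Hmu] t Ht.
    eexists; apply is_derive_integrand_param; try assumption.
    apply (seg_pos a b); assumption.
  + intros t Ht%seg_pos; try assumption.
    apply continuity_2d_pt_ext_loc with (2 := continuity_2d_weighted
      t e0 m0 alpha beta x Ht He Hm).
    destruct Hpos as [eps Heps].
    assert (Hd : 0 < Rmin eps t) by (apply Rmin_pos; [apply cond_pos | exact Ht]).
    exists (mkposreal _ Hd); intros u v Hu Hv; simpl in Hu, Hv.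
    symmetry; apply is_derive_unique.
    destruct (Heps u) as [Heu Hmu].
    { eapply Rlt_le_trans; [exact Hu | apply Rmin_l]. }
    apply is_derive_integrand_param; try assumption.
    assert (H := Rlt_le_trans _ _ _ Hv (Rmin_r _ _)).
    apply Rabs_lt_between' in H; lra.
  + apply (filter_imp _ _) with (2 := Hpos); intros u [Heu Hmu].
    apply ex_RInt_integrand; assumption.
- unfold moment.
  rewrite <- (RInt_scal (V := R_CompleteNormedModule) _ a b (- / 2))
    by (apply ex_RInt_weighted; assumption).
  apply RInt_ext; intros t Ht; apply is_derive_unique.
  apply is_derive_integrand_param; try assumption.
  apply (seg_pos a b); try assumption; lra.
Qed.

Lemma Derive_affine (h : R -> R) (c s x l : R) :
  is_derive h x l -> Derive (fun y => c - s * h y) x = - (s * l).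
Proof.
intros Hh; apply is_derive_unique.
replace (- (s * l)) with (0 - s * l) by ring.
apply (is_derive_minus (K := R_AbsRing) (V := R_NormedModule) (fun _ => c)
         (fun y => s * h y)).
- apply (is_derive_const (K := R_AbsRing) (V := R_NormedModule)).
- apply (is_derive_scal h), Hh.
Qed.

Lemma locally_ex_RInt_integrand (a b e m : R) :
  0 < a -> 0 < b -> 0 < e -> 0 < m ->
  locally b (fun x => ex_RInt (fun s => sqrt (s / (s * e + m))) a x).
Proof.
intros Ha Hb He Hm; apply (filter_imp (fun x => 0 < x)).
- intros x Hx; apply ex_RInt_integrand; assumption.
- apply (open_gt 0), Hb.
Qed.

Lemma dJ_R_eq (sigma t0 rho rho0 m e t : R) :
  0 < rho -> 0 < rho0 -> 0 < m -> 0 < e ->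
  dJ_R sigma t0 rho rho0 m e t = - (sigma * sqrt (rho / (rho * e + m))).
Proof.
intros Hrho Hrho0 Hm He; unfold dJ_R, J; apply Derive_affine.
apply (is_derive_RInt (V := R_NormedModule)
         (fun s => sqrt (s / (s * e + m)))) with (a := rho0).
- apply filter_imp with (2 := locally_ex_RInt_integrand rho0 rho e m Hrho0 Hrho He Hm).
  intros x; apply (RInt_correct (V := R_CompleteNormedModule)).
- apply continuous_integrand, affine_pos; lra.
Qed.

Lemma dJ_R0_eq (sigma t0 rho rho0 m e t : R) :
  0 < rho -> 0 < rho0 -> 0 < m -> 0 < e ->
  dJ_R0 sigma t0 rho rho0 m e t = sigma * sqrt (rho0 / (rho0 * e + m)).
Proof.
intros Hrho Hrho0 Hm He; unfold dJ_R0, J.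
rewrite (Derive_affine _ _ _ _ (- sqrt (rho0 / (rho0 * e + m)))); [ring|].
apply (is_derive_RInt' (V := R_NormedModule)
         (fun s => sqrt (s / (s * e + m)))) with (b := rho).
- apply filter_imp with (2 := locally_ex_RInt_integrand rho rho0 e m Hrho Hrho0 He Hm).
  intros x Hx; apply (RInt_correct (V := R_CompleteNormedModule)).
  apply ex_RInt_swap, Hx.
- apply continuous_integrand, affine_pos; lra.
Qed.

Lemma dJ_M_eq (sigma t0 rho rho0 m e t : R) :
  0 < rho -> 0 < rho0 -> 0 < m -> 0 < e ->
  dJ_M sigma t0 rho rho0 m e t = sigma / 2 * moment 0 1 rho0 rho e m.
Proof.
intros Hrho Hrho0 Hm He.
assert (H := is_derive_RInt_integrand rho0 rho e 0 0 1 m Hrho0 Hrho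
  ltac:(lra) ltac:(lra)).
replace (e + 0 * m) with e in H by ring; replace (0 + 1 * m) with m in H by ring.
unfold dJ_M, J; rewrite (Derive_affine _ _ _ _ (- / 2 * moment 0 1 rho0 rho e m));
  [field|].
apply is_derive_ext with (2 := H); intros u; apply RInt_ext; intros s _.
f_equal; f_equal; ring.
Qed.

Lemma dJ_E_eq (sigma t0 rho rho0 m e t : R) :
  0 < rho -> 0 < rho0 -> 0 < m -> 0 < e ->
  dJ_E sigma t0 rho rho0 m e t = sigma / 2 * moment 1 0 rho0 rho e m.
Proof.
intros Hrho Hrho0 Hm He.
assert (H := is_derive_RInt_integrand rho0 rho 0 m 1 0 e Hrho0 Hrho
  ltac:(lra) ltac:(lra)).
replace (m + 0 * e) with m in H by ring; replace (0 + 1 * e) with e in H by ring.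
unfold dJ_E, J; rewrite (Derive_affine _ _ _ _ (- / 2 * moment 1 0 rho0 rho e m));
  [field|].
apply is_derive_ext with (2 := H); intros u; apply RInt_ext; intros s _.
f_equal; f_equal; ring.
Qed.

(** Since [weight tau e m] is [sqrt tau * psi (tau * e + m)] with [psi] smooth on
    the positive half-line, a Lipschitz constant in [e] and [m] that is uniform
    in [tau] comes from one for [psi] on the compact range [c, q1] of
    [tau * e + m]. *)
Lemma locally_lipschitz_moment {I : Type} (p : I -> R) (alpha beta : R)
    (a b e m : (I -> R) -> R) :
  locally_lipschitz p a -> locally_lipschitz p b ->
  locally_lipschitz p e -> locally_lipschitz p m ->
  0 < a p -> 0 < b p -> 0 < e p -> 0 < m p ->
  locally_lipschitz p (fun v => moment alpha beta (a v) (b v) (e v) (m v)).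
Proof.
intros Ha Hb He Hm Hap Hbp Hep Hmp.
set (hi := a p + b p); set (c := m p / 2).
set (q1 := hi * (e p + 1) + (m p + 1)).
set (psi := fun q => sqrt (/ q) * / q).
assert (Hc : 0 < c) by (unfold c; lra).
assert (Hhi : 0 < hi) by (unfold hi; lra).
assert (Hcq1 : c <= q1) by (unfold c, q1; nra).
destruct (lipschitz_of_C1 psi (Derive psi) c q1) as (Lpsi & HLpsi & Hpsi).
{ intros q Hq; apply Derive_correct; unfold psi; auto_derive.
  repeat split; try lra; apply Rinv_0_lt_compat; lra. }
{ intros q Hq.
  set (psi' := fun q => - / q ^ 2 * / (2 * sqrt (/ q)) * / q
                        + sqrt (/ q) * - / q ^ 2).
  assert (Hsq : forall x, 0 < x -> 0 < sqrt (/ x)).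
  { intros x Hx; apply sqrt_lt_R0, Rinv_0_lt_compat, Hx. }
  apply continuous_ext_loc with psi'.
  - apply (filter_imp (fun x => 0 < x)); [|apply (open_gt 0); lra].
    intros x Hx; symmetry; apply is_derive_unique; unfold psi, psi'; auto_derive.
    + repeat split; try lra; apply Rinv_0_lt_compat, Hx.
    + specialize (Hsq x Hx); field; lra.
  - apply (ex_derive_continuous (K := R_AbsRing) (V := R_NormedModule)).
    unfold psi'; auto_derive.
    specialize (Hsq q ltac:(lra)).
    assert (q * (q * 1) <> 0) by nra.
    repeat split; try lra; apply Rinv_0_lt_compat; lra. }
assert (Hweight : forall tau e m, 0 <= tau -> 0 < tau * e + m ->
          weight tau e m = sqrt tau * psi (tau * e + m)).
{ intros tau e1 m1 Htau Hq; unfold weight, psi, Rdiv.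
  rewrite sqrt_mult; [ring | exact Htau | apply Rlt_le, Rinv_0_lt_compat, Hq]. }
assert (Hnear : near p (fun v => (0 < e v < e p + 1) /\ c < m v < m p + 1)).
{ apply near_and.
  - apply (locally_lipschitz_near p e (fun x => 0 < x < e p + 1) He).
    apply filter_and; [apply (open_gt 0) | apply (open_lt (e p + 1))]; lra.
  - apply (locally_lipschitz_near p m (fun x => c < x < m p + 1) Hm).
    apply filter_and; [apply (open_gt c) | apply (open_lt (m p + 1))];
      unfold c; lra. }
destruct Hnear as [d0 H0], He as (d1 & L1 & HL1 & H1), Hm as (d2 & L2 & HL2 & H2).
assert (Hd : 0 < Rmin d0 (Rmin d1 d2)) by (repeat apply Rmin_pos; apply cond_pos).
assert (Hq : forall v tau, sup_close d0 v p -> 0 <= tau <= hi ->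
          c <= tau * e v + m v <= q1).
{ intros v tau Hv Htau; destruct (H0 v Hv) as [Hev Hmv]; simpl in Hev, Hmv.
  assert (0 <= tau * e v) by (apply Rmult_le_pos; lra).
  assert (tau * e v <= hi * (e p + 1)) by (apply Rmult_le_compat; lra).
  unfold q1; lra. }
set (W := (Rabs alpha * hi + Rabs beta) * sqrt hi).
assert (HW : forall tau, 0 <= tau <= hi ->
          Rabs ((alpha * tau + beta) * sqrt tau) <= W).
{ intros tau Htau; rewrite Rabs_mult, (Rabs_pos_eq (sqrt tau)) by apply sqrt_pos.
  apply Rmult_le_compat; try apply Rabs_pos; try apply sqrt_pos.
  - eapply Rle_trans; [apply Rabs_triang|]; apply Rplus_le_compat_r.
    rewrite Rabs_mult, (Rabs_pos_eq tau) by lra.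
    apply Rmult_le_compat_l; [apply Rabs_pos | lra].
  - apply sqrt_le_1_alt, Htau. }
assert (HW0 : 0 <= W).
{ apply Rle_trans with (2 := HW 0 ltac:(lra)), Rabs_pos. }
set (Kpsi := Rabs (psi c) + Lpsi * (q1 - c)).
assert (HKpsi : 0 <= Kpsi).
{ apply Rplus_le_le_0_compat; [apply Rabs_pos | apply Rmult_le_pos; lra]. }
apply (locally_lipschitz_RInt p
         (fun tau v => (alpha * tau + beta) * weight tau (e v) (m v)) a b
         0 hi (W * Kpsi) (W * (Lpsi * (hi * L1 + L2))) (mkposreal _ Hd)).
- exact Ha.
- exact Hb.
- unfold hi; lra.
- unfold hi; lra.
- apply Rmult_le_pos; assumption.
- apply Rmult_le_pos; [exact HW0|]; apply Rmult_le_pos; [exact HLpsi|].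
  apply Rplus_le_le_0_compat; [apply Rmult_le_pos; lra | assumption].
- intros v tau [Hv _]%sup_close_Rmin Htau.
  specialize (Hq v tau Hv Htau); split.
  + apply continuous_weighted; lra.
  + rewrite Hweight, <- Rmult_assoc, Rabs_mult by lra.
    apply Rmult_le_compat; try apply Rabs_pos; [apply HW, Htau|].
    replace (psi (tau * e v + m v))
      with (psi c + (psi (tau * e v + m v) - psi c)) by ring.
    eapply Rle_trans; [apply Rabs_triang|]; apply Rplus_le_compat_l.
    eapply Rle_trans; [apply Hpsi; lra|].
    apply Rmult_le_compat_l; [exact HLpsi | rewrite Rabs_pos_eq; lra].
- intros v w C tau [Hv [Hv1 Hv2]%sup_close_Rmin]%sup_close_Rmin
    [Hw [Hw1 Hw2]%sup_close_Rmin]%sup_close_Rmin HC Hvw Htau.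
  pose proof (Hq v tau Hv Htau); pose proof (Hq w tau Hw Htau).
  rewrite !Hweight, <- !Rmult_assoc, <- Rmult_minus_distr_l, Rabs_mult by lra.
  rewrite !(Rmult_assoc W).
  apply Rmult_le_compat; try apply Rabs_pos; [apply HW, Htau|].
  eapply Rle_trans; [apply Hpsi; lra|].
  rewrite Rmult_assoc; apply Rmult_le_compat_l; [exact HLpsi|].
  replace (tau * e v + m v - (tau * e w + m w))
    with (tau * (e v - e w) + (m v - m w)) by ring.
  eapply Rle_trans; [apply Rabs_triang|].
  rewrite Rabs_mult, (Rabs_pos_eq tau), Rmult_plus_distr_r, (Rmult_assoc hi) by lra.
  apply Rplus_le_compat; [|auto].
  apply Rmult_le_compat; try apply Rabs_pos; [lra | lra | auto].
Qed.

(** * The denominators do not vanish *)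

Lemma weight_pos (tau e m : R) : 0 < tau -> 0 < e -> 0 < m -> 0 < weight tau e m.
Proof.
intros Ht He Hm; pose proof (affine_pos tau e m (Rlt_le _ _ Ht) He Hm).
apply Rdiv_lt_0_compat; [|assumption].
apply sqrt_lt_R0, Rdiv_lt_0_compat; assumption.
Qed.

(** For fixed [e] and [m] the weight is largest at [tau = m / (2 * e)].  After
    squaring and clearing denominators the bound reads
    [27 * m ^ 2 * (tau * e) <= 4 * (tau * e + m) ^ 3], and the difference of the
    two sides is [(2 * tau * e - m) ^ 2 * (tau * e + 4 * m)]. *)
Lemma weight_le (tau e m : R) :
  0 < tau -> 0 < e -> 0 < m -> weight tau e m <= 2 / (m * sqrt (27 * e)).
Proof.
intros Ht He Hm.
assert (Hw := weight_pos tau e m Ht He Hm).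
assert (Hq := affine_pos tau e m (Rlt_le _ _ Ht) He Hm).
assert (Hs : 0 < sqrt (27 * e)) by (apply sqrt_lt_R0; lra).
assert (Hr : 0 < m * sqrt (27 * e)) by (apply Rmult_lt_0_compat; assumption).
apply Rsqr_incr_0; [|lra | apply Rlt_le, Rdiv_lt_0_compat; lra].
unfold weight in *; set (q := tau * e + m) in *.
rewrite !Rsqr_div', Rsqr_mult, !Rsqr_sqrt
  by (try lra; apply Rlt_le, Rdiv_lt_0_compat; assumption).
assert (Hkey : 0 <= (2 * (tau * e) - m) ^ 2 * (tau * e + 4 * m)).
{ apply Rmult_le_pos; [apply pow2_ge_0 | nra]. }
apply Rmult_le_reg_r with (q ^ 3 * (m * m * (27 * e))).
{ apply Rmult_lt_0_compat; [apply pow_lt, Hq|].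
  repeat apply Rmult_lt_0_compat; lra. }
unfold Rsqr.
replace (tau / q / (q * q) * (q ^ 3 * (m * m * (27 * e))))
  with (tau * (m * m * (27 * e))) by (field; lra).
replace (2 * 2 / (m * m * (27 * e)) * (q ^ 3 * (m * m * (27 * e))))
  with (4 * q ^ 3) by (field; lra).
unfold q; nra.
Qed.

Lemma RInt_linear (a b : R) :
  RInt (fun tau => b - tau) a b = (b - a) ^ 2 / 2.
Proof.
apply is_RInt_unique.
replace ((b - a) ^ 2 / 2) with (- (b - b) ^ 2 / 2 - - (b - a) ^ 2 / 2) by field.
apply (is_RInt_derive (V := R_CompleteNormedModule) (fun x => - (b - x) ^ 2 / 2)).
- intros x _; auto_derive; [trivial | field].
- intros x _; apply (ex_derive_continuous (K := R_AbsRing) (V := R_NormedModule)).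
  auto_derive; trivial.
Qed.

(** The quantity is the integral from [a] to [b] of [(b - tau) * weight].
    Whatever the order of [a] and [b], it is nonnegative, because [b - tau]
    changes sign together with the orientation of the segment; bounding the
    weight by its maximum leaves the integral of [b - tau]. *)
Lemma moment_excess_bounds (a b e m : R) :
  0 < a -> 0 < b -> 0 < e -> 0 < m ->
  0 <= b * moment 0 1 a b e m - moment 1 0 a b e m
    <= 2 / (m * sqrt (27 * e)) * ((b - a) ^ 2 / 2).
Proof.
intros Ha Hb He Hm; set (c := 2 / (m * sqrt (27 * e))).
assert (Hex : ex_RInt (fun tau => (b - tau) * weight tau e m) a b).
{ apply (ex_RInt_ext (fun tau => (-1 * tau + b) * weight tau e m)).
  - intros; simpl; f_equal; ring.
  - apply ex_RInt_weighted; assumption. }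
assert (Hlin : ex_RInt (fun tau => c * (b - tau)) a b).
{ apply (ex_RInt_continuous (V := R_CompleteNormedModule)); intros x _.
  apply (ex_derive_continuous (K := R_AbsRing) (V := R_NormedModule)).
  auto_derive; trivial. }
replace (b * moment 0 1 a b e m - moment 1 0 a b e m)
  with (RInt (fun tau => (b - tau) * weight tau e m) a b).
2:{ symmetry; unfold moment.
    rewrite <- (RInt_scal (V := R_CompleteNormedModule) _ a b b)
      by (apply ex_RInt_weighted; assumption).
    etransitivity.
    { symmetry; apply (RInt_minus (V := R_CompleteNormedModule)).
      - apply (ex_RInt_scal (V := R_NormedModule)), ex_RInt_weighted; assumption.
      - apply ex_RInt_weighted; assumption. }
    apply RInt_ext; intros x _; unfold minus, plus, opp, scal; simpl.
    unfold mult; simpl; ring. }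
rewrite <- RInt_linear.
replace (c * RInt (fun tau => b - tau) a b)
  with (RInt (fun tau => c * (b - tau)) a b).
2:{ apply (RInt_scal (V := R_CompleteNormedModule) (fun tau => b - tau) a b c).
    apply (ex_RInt_continuous (V := R_CompleteNormedModule)); intros x _.
    apply (ex_derive_continuous (K := R_AbsRing) (V := R_NormedModule)).
    auto_derive; trivial. }
assert (Hzero : forall x y, RInt (fun _ => 0) x y = 0).
{ intros x y; rewrite RInt_const; apply Rmult_0_r. }
destruct (Rle_dec a b) as [Hab|Hba].
- split.
  + rewrite <- (Hzero a b); apply RInt_le; auto; [apply ex_RInt_const|].
    intros x Hx; apply Rmult_le_pos; [lra|].
    apply Rlt_le, weight_pos; lra.
  + apply RInt_le; auto; intros x Hx.
    rewrite Rmult_comm; apply Rmult_le_compat_r; [lra | apply weight_le; lra].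
- rewrite <- (opp_RInt_swap (fun tau => (b - tau) * _)),
    <- (opp_RInt_swap (fun tau => c * _)) by (apply ex_RInt_swap; assumption).
  apply ex_RInt_swap in Hex; apply ex_RInt_swap in Hlin.
  unfold opp; simpl; split.
  + apply Ropp_0_ge_le_contravar, Rle_ge.
    rewrite <- (Hzero b a); apply RInt_le; auto; [lra | apply ex_RInt_const|].
    intros x Hx; assert (0 < weight x e m) by (apply weight_pos; lra).
    nra.
  + apply Ropp_le_contravar, RInt_le; auto; [lra|]; intros x Hx.
    assert (weight x e m <= c) by (apply weight_le; lra).
    nra.
Qed.

Lemma den1_eq (sigma t0 rho rho0 m e t de drho0 : R) :
  sigma = 1 \/ sigma = -1 -> 0 < rho -> 0 < rho0 -> 0 < m -> 0 < e ->
  den1 sigma t0 rho rho0 m e t de drho0 =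
  (de / 2 * (rho * moment 0 1 rho0 rho e m - moment 1 0 rho0 rho e m)
     - drho0 * sqrt (rho0 / (rho0 * e + m))) / sqrt (rho / (rho * e + m)).
Proof.
intros Hsigma Hrho Hrho0 Hm He; unfold den1, F, G.
rewrite dJ_R_eq, dJ_R0_eq, dJ_M_eq, dJ_E_eq by assumption.
assert (Hs : 0 < sqrt (rho / (rho * e + m))).
{ apply sqrt_lt_R0, Rdiv_lt_0_compat; [|apply affine_pos]; lra. }
destruct Hsigma; subst sigma; field; lra.
Qed.

(** Both terms in the numerator of [den1_eq] are nonpositive when [de <= 0], and
    the second one is negative.  When [de] is positive, the first condition is
    excluded and the second one says that the bound of [moment_excess_bounds],
    multiplied by [de / 2], stays below the subtracted term. *)
Lemma den1_lt_0 (sigma t0 rho rho0 m e t de drho0 : R) :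
  sigma = 1 \/ sigma = -1 -> 0 < rho -> 0 < rho0 -> 0 < m -> 0 < e ->
  0 < drho0 ->
  sign de <> sign drho0 \/
    Rabs (de * (rho0 - rho) ^ 2 / (2 * m * sqrt (27 * e)))
    < Rabs (drho0 * sqrt rho0 / sqrt (e * rho0 + m)) ->
  den1 sigma t0 rho rho0 m e t de drho0 < 0.
Proof.
intros Hsigma Hrho Hrho0 Hm He Hd H12.
rewrite den1_eq by assumption.
assert (Hq0 : 0 < rho0 * e + m) by (apply affine_pos; lra).
assert (Hs : 0 < sqrt (rho / (rho * e + m))).
{ apply sqrt_lt_R0, Rdiv_lt_0_compat; [|apply affine_pos]; lra. }
assert (Hs0 : 0 < sqrt (rho0 / (rho0 * e + m))).
{ apply sqrt_lt_R0, Rdiv_lt_0_compat; lra. }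
assert (HN := moment_excess_bounds rho0 rho e m Hrho0 Hrho He Hm).
set (N := rho * _ - _) in *; clearbody N.
apply Rmult_lt_reg_r with (1 := Hs).
unfold Rdiv at 1; rewrite Rmult_assoc, Rinv_l, Rmult_1_r, Rmult_0_l by lra.
assert (Hlead := Rmult_lt_0_compat _ _ Hd Hs0).
destruct (Rle_dec de 0) as [Hde|Hde].
{ nra. }
apply Rnot_le_lt in Hde.
destruct H12 as [H12|H12].
{ contradict H12; rewrite !sign_eq_1 by assumption; reflexivity. }
assert (H27 : 0 < sqrt (27 * e)) by (apply sqrt_lt_R0; lra).
rewrite (Rabs_pos_eq (drho0 * _ / _)) in H12.
2:{ apply Rlt_le, Rdiv_lt_0_compat; [apply Rmult_lt_0_compat|];
      try apply sqrt_lt_R0; lra. }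
replace (drho0 * sqrt rho0 / sqrt (e * rho0 + m))
  with (drho0 * sqrt (rho0 / (rho0 * e + m))) in H12.
2:{ rewrite sqrt_div by lra; rewrite (Rmult_comm e); unfold Rdiv; ring. }
apply Rle_lt_trans with (1 := Rle_abs _) in H12.
apply Rlt_minus, Rle_lt_trans with (2 := H12).
apply Rle_trans with (de / 2 * (2 / (m * sqrt (27 * e)) * ((rho - rho0) ^ 2 / 2))).
- apply Rmult_le_compat_l; lra.
- apply Req_le; field; lra.
Qed.

Lemma den2_neq_0 (sigma delta rho m e : R) :
  sigma = 1 \/ sigma = -1 -> delta = 1 \/ delta = -1 ->
  0 < rho -> 0 < m -> 0 < e -> delta <> sigma \/ 2 * m <> rho ->
  den2 sigma delta rho m e <> 0.
Proof.
intros Hsigma Hdelta Hrho Hm He H; unfold den2.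
assert (Hq : 0 < 2 * m / rho) by (apply Rdiv_lt_0_compat; lra).
assert (H1 : 0 < sqrt (2 * e + 2 * m / rho)) by (apply sqrt_lt_R0; lra).
assert (H2 : 0 < sqrt (1 + 2 * e)) by (apply sqrt_lt_R0; lra).
assert (Hds : delta * sigma = -1 \/ (delta = sigma /\ delta * sigma = 1)).
{ destruct Hsigma, Hdelta; subst; lra. }
destruct Hds as [->|[Heq ->]]; [lra|].
destruct H as [H|H]; [contradiction|].
intros Hz; apply H.
assert (Hsq : 2 * e + 2 * m / rho = 1 + 2 * e) by (apply sqrt_inj; lra).
apply Rmult_eq_reg_r with (/ rho); [|apply Rinv_neq_0_compat; lra].
rewrite Rinv_r by lra; unfold Rdiv in Hsq; lra.
Qed.

(** * The field of the system is locally Lipschitz *)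

Lemma near_pos {I : Type} (p : I -> R) f :
  locally_lipschitz p f -> 0 < f p -> near p (fun v => 0 < f v).
Proof.
intros Hf Hp; apply (locally_lipschitz_near p f (fun x => 0 < x) Hf).
apply (open_gt 0), Hp.
Qed.

Lemma near_neq_0 {I : Type} (p : I -> R) f :
  locally_lipschitz p f -> f p <> 0 -> near p (fun v => f v <> 0).
Proof.
intros Hf Hp; apply (locally_lipschitz_near p f (fun x => x <> 0) Hf).
apply (open_neq 0), Hp.
Qed.

Create HintDb lip.
#[local] Hint Resolve locally_lipschitz_const locally_lipschitz_coord
  locally_lipschitz_plus locally_lipschitz_mult locally_lipschitz_opp
  locally_lipschitz_minus locally_lipschitz_div locally_lipschitz_moment : lip.

Section FieldLipschitz.

Context {I : Type} (p : I -> R) (sigma t0 : R) (rho rho0 m e t : (I -> R) -> R).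
Hypotheses (Hsigma : sigma = 1 \/ sigma = -1).
Hypotheses (Lrho : locally_lipschitz p rho) (Lrho0 : locally_lipschitz p rho0)
  (Lm : locally_lipschitz p m) (Le : locally_lipschitz p e).
Hypotheses (Prho : 0 < rho p) (Prho0 : 0 < rho0 p) (Pm : 0 < m p) (Pe : 0 < e p).

Lemma near_data_pos :
  near p (fun v => 0 < rho v /\ 0 < rho0 v /\ 0 < m v /\ 0 < e v).
Proof. repeat apply near_and; apply near_pos; assumption. Qed.

Lemma locally_lipschitz_integrand (a : (I -> R) -> R) :
  locally_lipschitz p a -> 0 < a p ->
  locally_lipschitz p (fun v => sqrt (a v / (a v * e v + m v))).
Proof.
intros La Pa.
assert (Hq : 0 < a p * e p + m p) by (apply affine_pos; lra).
apply locally_lipschitz_sqrt; [|apply Rdiv_lt_0_compat; assumption].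
apply locally_lipschitz_div; auto with lip; lra.
Qed.

Lemma locally_lipschitz_dJ_R :
  locally_lipschitz p (fun v => dJ_R sigma t0 (rho v) (rho0 v) (m v) (e v) (t v)).
Proof.
apply locally_lipschitz_ext
  with (fun v => - (sigma * sqrt (rho v / (rho v * e v + m v)))).
- apply near_imp with (2 := near_data_pos); intros v Hv; apply dJ_R_eq; apply Hv.
- auto using locally_lipschitz_integrand with lip.
Qed.

Lemma locally_lipschitz_dJ_R0 :
  locally_lipschitz p (fun v => dJ_R0 sigma t0 (rho v) (rho0 v) (m v) (e v) (t v)).
Proof.
apply locally_lipschitz_ext
  with (fun v => sigma * sqrt (rho0 v / (rho0 v * e v + m v))).
- apply near_imp with (2 := near_data_pos); intros v Hv; apply dJ_R0_eq; apply Hv.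
- auto using locally_lipschitz_integrand with lip.
Qed.

Lemma locally_lipschitz_dJ_M :
  locally_lipschitz p (fun v => dJ_M sigma t0 (rho v) (rho0 v) (m v) (e v) (t v)).
Proof.
apply locally_lipschitz_ext
  with (fun v => sigma / 2 * moment 0 1 (rho0 v) (rho v) (e v) (m v)).
- apply near_imp with (2 := near_data_pos); intros v Hv; apply dJ_M_eq; apply Hv.
- auto with lip.
Qed.

Lemma locally_lipschitz_dJ_E :
  locally_lipschitz p (fun v => dJ_E sigma t0 (rho v) (rho0 v) (m v) (e v) (t v)).
Proof.
apply locally_lipschitz_ext
  with (fun v => sigma / 2 * moment 1 0 (rho0 v) (rho v) (e v) (m v)).
- apply near_imp with (2 := near_data_pos); intros v Hv; apply dJ_E_eq; apply Hv.
- auto with lip.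
Qed.

Lemma dJ_R_neq_0 : dJ_R sigma t0 (rho p) (rho0 p) (m p) (e p) (t p) <> 0.
Proof.
rewrite dJ_R_eq by assumption.
assert (Hs : 0 < sqrt (rho p / (rho p * e p + m p))).
{ apply sqrt_lt_R0, Rdiv_lt_0_compat; [|apply affine_pos]; lra. }
destruct Hsigma as [-> | ->]; lra.
Qed.

Lemma locally_lipschitz_G :
  locally_lipschitz p (fun v => G sigma t0 (rho v) (rho0 v) (m v) (e v) (t v)).
Proof.
apply locally_lipschitz_div.
- apply locally_lipschitz_opp, locally_lipschitz_dJ_M.
- apply locally_lipschitz_dJ_R.
- apply dJ_R_neq_0.
Qed.

Variables (de drho0 : (I -> R) -> R).
Hypotheses (Lde : locally_lipschitz p de) (Ldrho0 : locally_lipschitz p drho0).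

Lemma locally_lipschitz_F :
  locally_lipschitz p
    (fun v => F sigma t0 (rho v) (rho0 v) (m v) (e v) (t v) (de v) (drho0 v)).
Proof.
apply locally_lipschitz_div.
- auto using locally_lipschitz_dJ_E, locally_lipschitz_dJ_R0 with lip.
- apply locally_lipschitz_dJ_R.
- apply dJ_R_neq_0.
Qed.

Lemma locally_lipschitz_den1 :
  locally_lipschitz p
    (fun v => den1 sigma t0 (rho v) (rho0 v) (m v) (e v) (t v) (de v) (drho0 v)).
Proof.
unfold den1; auto using locally_lipschitz_G, locally_lipschitz_F with lip.
Qed.

Lemma locally_lipschitz_sqrt_energy :
  locally_lipschitz p (fun v => sqrt (1 + 2 * e v)).
Proof. apply locally_lipschitz_sqrt; [auto with lip | lra]. Qed.

Lemma locally_lipschitz_speed :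
  locally_lipschitz p (fun v => sqrt (2 * e v + 2 * m v / rho v)).
Proof.
assert (0 < 2 * m p / rho p) by (apply Rdiv_lt_0_compat; lra).
apply locally_lipschitz_sqrt; [|lra].
apply locally_lipschitz_plus; [auto with lip|].
apply locally_lipschitz_div; auto with lip; lra.
Qed.

Variables (delta : R) (z drho : (I -> R) -> R).
Hypotheses (Lz : locally_lipschitz p z) (Ldrho : locally_lipschitz p drho)
  (Hz : 1 + z p <> 0).

Lemma locally_lipschitz_den2 :
  locally_lipschitz p (fun v => den2 sigma delta (rho v) (m v) (e v)).
Proof.
unfold den2.
auto using locally_lipschitz_speed, locally_lipschitz_sqrt_energy with lip.
Qed.

Lemma locally_lipschitz_A :
  locally_lipschitz p (fun v => A sigma (z v) (rho v) (m v) (e v)).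
Proof.
apply locally_lipschitz_mult; [|apply locally_lipschitz_sqrt_energy].
apply locally_lipschitz_div; auto using locally_lipschitz_speed with lip.
Qed.

Hypotheses
  (Hden1 : den1 sigma t0 (rho p) (rho0 p) (m p) (e p) (t p) (de p) (drho0 p) <> 0)
  (Hden2 : den2 sigma delta (rho p) (m p) (e p) <> 0).

Lemma locally_lipschitz_common_den :
  locally_lipschitz p (fun v => rho v * den2 sigma delta (rho v) (m v) (e v) *
    den1 sigma t0 (rho v) (rho0 v) (m v) (e v) (t v) (de v) (drho0 v)).
Proof. auto using locally_lipschitz_den1, locally_lipschitz_den2 with lip. Qed.

Lemma common_den_neq_0 : rho p * den2 sigma delta (rho p) (m p) (e p) *
  den1 sigma t0 (rho p) (rho0 p) (m p) (e p) (t p) (de p) (drho0 p) <> 0.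
Proof.
repeat apply Rmult_integral_contrapositive_currified; try assumption; lra.
Qed.

Lemma locally_lipschitz_rhs_r :
  locally_lipschitz p (fun v => rhs_r sigma delta t0 (z v) (rho v) (drho v)
    (rho0 v) (drho0 v) (e v) (de v) (m v) (t v)).
Proof.
apply locally_lipschitz_minus; apply locally_lipschitz_div;
  auto using locally_lipschitz_G, locally_lipschitz_A, locally_lipschitz_den1,
    locally_lipschitz_common_den, common_den_neq_0,
    locally_lipschitz_sqrt_energy with lip.
Qed.

Lemma locally_lipschitz_rhs_t :
  locally_lipschitz p
    (fun v => rhs_t sigma delta (rho v) (drho v) (e v) (m v)).
Proof.
apply locally_lipschitz_div; auto using locally_lipschitz_den2 with lip.
Qed.

Lemma locally_lipschitz_rhs_M :
  locally_lipschitz p (fun v => rhs_M sigma delta t0 (z v) (rho v) (drho v)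
    (rho0 v) (drho0 v) (e v) (de v) (m v) (t v)).
Proof.
unfold rhs_M, pow.
apply locally_lipschitz_minus; apply locally_lipschitz_div;
  auto 10 using locally_lipschitz_F, locally_lipschitz_A, locally_lipschitz_den1,
    locally_lipschitz_common_den, common_den_neq_0,
    locally_lipschitz_sqrt_energy with lip.
Qed.

End FieldLipschitz.

(** * The system as an autonomous one *)

(** The independent variable is counted among the unknowns, which makes the
    system autonomous: the field depends on it only through the state. *)
Inductive coord : Set := Cz | Cr | Ct | CM.

Lemma in_coords (c : coord) : In c (Cz :: Cr :: Ct :: CM :: nil).
Proof. destruct c; simpl; tauto. Qed.

Definition state (z r t m : R) (c : coord) : R :=
  match c with Cz => z | Cr => r | Ct => t | CM => m end.

Definition field (sigma delta t0 : R) (E R_0 Rf : R -> R) (c : coord)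
    (v : coord -> R) : R :=
  match c with
  | Cz => 1
  | Cr => rhs_r sigma delta t0 (v Cz) (Rf (v Cz)) (Derive Rf (v Cz))
            (R_0 (v Cr)) (Derive R_0 (v Cr)) (E (v Cr)) (Derive E (v Cr))
            (v CM) (v Ct)
  | Ct => rhs_t sigma delta (Rf (v Cz)) (Derive Rf (v Cz)) (E (v Cr)) (v CM)
  | CM => rhs_M sigma delta t0 (v Cz) (Rf (v Cz)) (Derive Rf (v Cz))
            (R_0 (v Cr)) (Derive R_0 (v Cr)) (E (v Cr)) (Derive E (v Cr))
            (v CM) (v Ct)
  end.

Lemma locally_lipschitz_smooth {I : Type} (p : I -> R) (D : R -> Prop)
    (f : R -> R) (i : I) :
  open D -> smooth_on D f -> D (p i) ->
  locally_lipschitz p (fun v => f (v i)) /\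
  locally_lipschitz p (fun v => Derive f (v i)).
Proof.
intros HD Hf Hp.
split; (apply locally_lipschitz_comp; [apply locally_lipschitz_coord|]);
  apply (filter_imp D); try (apply HD, Hp); intros x Hx.
- split; [apply (Hf 1%nat x Hx) | apply (Hf 2%nat x Hx)].
- split; [apply (Hf 2%nat x Hx) | apply (Hf 3%nat x Hx)].
Qed.

(** This identifies the first component of a solution of the autonomous system
    with the independent variable. *)
Lemma unit_speed (u : R -> R) (z0 h : R) :
  u z0 = z0 -> (forall z, Rabs (z - z0) < h -> is_derive u z 1) ->
  forall z, Rabs (z - z0) < h -> u z = z.
Proof.
intros Hu0 Hu z Hz.
assert (H := Rabs_increment_le (fun x => u x - x) (fun _ => 1 - 1) 0 z0 z).
cbv beta in H; rewrite Hu0, Rmult_0_l in H.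
apply Rminus_diag_uniq, Rabs_eq_0, Rle_antisym; [|apply Rabs_pos].
replace (u z - z) with (u z - z - (z0 - z0)) by ring; apply H.
- intros t Ht.
  apply (is_derive_minus (K := R_AbsRing) (V := R_NormedModule) u (fun x => x)).
  + apply Hu; lra.
  + apply (is_derive_id (K := R_AbsRing)).
- intros; rewrite Rminus_diag, Rabs_R0; lra.
Qed.

Theorem proposition1p16
  (sigma delta t0 : R)
  (Hsigma : sigma = 1 \/ sigma = -1)
  (Hdelta : delta = 1 \/ delta = -1)
  (Ht0 : 0 < t0)
  (Dr Dz : R -> Prop) (HDr : open Dr) (HDz : open Dz)
  (E R_0 Rf : R -> R)
  (HE : smooth_on Dr E) (HR_0 : smooth_on Dr R_0) (HRf : smooth_on Dz Rf)
  (HEpos : forall x, Dr x -> 0 < E x)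
  (HRfpos : forall z, Dz z -> 0 < Rf z)
  (HR_0' : forall x, Dr x -> 0 < Derive R_0 x)
  (z0 r0 tau0 M0 : R)
  (Hz0 : Dz z0) (Hz0' : 1 + z0 <> 0) (Hr0 : Dr r0)
  (Hr0pos : 0 < r0) (Htau0pos : 0 < tau0) (HM0pos : 0 < M0)
  (HO : in_O sigma t0 (Rf z0) (R_0 r0) (E r0) M0 tau0)
  (Happ : delta <> sigma \/ 2 * M0 <> Rf z0)
  (H12 : sign (Derive E r0) <> sign (Derive R_0 r0) \/
         Rabs (Derive E r0 * (R_0 r0 - Rf z0) ^ 2 / (2 * M0 * sqrt (27 * E r0)))
         < Rabs (Derive R_0 r0 * sqrt (R_0 r0) / sqrt (E r0 * R_0 r0 + M0))) :
  exists a b : R, a < z0 < b /\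
  exists r t M : R -> R,
    is_solution sigma delta t0 Dr Dz E R_0 Rf a b r t M /\
    r z0 = r0 /\ t z0 = tau0 /\ M z0 = M0 /\
    (forall r1 t1 M1 : R -> R,
       is_solution sigma delta t0 Dr Dz E R_0 Rf a b r1 t1 M1 ->
       r1 z0 = r0 -> t1 z0 = tau0 -> M1 z0 = M0 ->
       forall z : R, a < z < b -> r1 z = r z /\ t1 z = t z /\ M1 z = M z).
Proof.
set (p := state z0 r0 tau0 M0).
destruct HO as [(Hrho & Hrho0 & _ & _ & He) _].
destruct (locally_lipschitz_smooth p Dz Rf Cz HDz HRf Hz0) as [Lrho Ldrho].
destruct (locally_lipschitz_smooth p Dr R_0 Cr HDr HR_0 Hr0) as [Lrho0 Ldrho0].
destruct (locally_lipschitz_smooth p Dr E Cr HDr HE Hr0) as [Le Lde].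
assert (Lz := locally_lipschitz_coord p Cz).
assert (Lr := locally_lipschitz_coord p Cr).
assert (Lt := locally_lipschitz_coord p Ct).
assert (Lm := locally_lipschitz_coord p CM).
assert (Hden1 := den1_lt_0 sigma t0 (Rf z0) (R_0 r0) M0 (E r0) tau0
  (Derive E r0) (Derive R_0 r0) Hsigma Hrho Hrho0 HM0pos He (HR_0' r0 Hr0) H12).
apply Rlt_not_eq in Hden1.
assert (Hden2 := den2_neq_0 sigma delta (Rf z0) M0 (E r0) Hsigma Hdelta Hrho
  HM0pos He Happ).
(* The set in which solutions must stay for the system to make sense; by the
   nonvanishing of both denominators it is a neighbourhood of the initial
   point. *)
set (dom := fun v : coord -> R => Dz (v Cz) /\ Dr (v Cr) /\
  well_defined sigma delta t0 (v Cz) (Rf (v Cz)) (R_0 (v Cr))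
    (Derive R_0 (v Cr)) (E (v Cr)) (Derive E (v Cr)) (v CM) (v Ct)).
assert (Hdom : near p dom).
{ assert (Ndz : near p (fun v => Dz (v Cz)))
    by (apply (locally_lipschitz_near p _ Dz Lz), HDz, Hz0).
  assert (Ndr : near p (fun v => Dr (v Cr)))
    by (apply (locally_lipschitz_near p _ Dr Lr), HDr, Hr0).
  assert (Nz : near p (fun v => 1 + v Cz <> 0)).
  { apply near_neq_0; [|exact Hz0'].
    apply locally_lipschitz_plus; [apply locally_lipschitz_const | exact Lz]. }
  assert (Nrho0 := near_pos p _ Lrho0 Hrho0).
  assert (Nt := near_pos p _ Lt Htau0pos).
  assert (Nm := near_pos p _ Lm HM0pos).
  assert (Nd1 := near_neq_0 p _ (locally_lipschitz_den1 p sigma t0 _ _ _ _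
    (fun v => v Ct) Hsigma Lrho Lrho0 Lm Le Hrho Hrho0 HM0pos He _ _ Lde Ldrho0)
    Hden1).
  assert (Nd2 := near_neq_0 p _ (locally_lipschitz_den2 p sigma _ _ _
    Lrho Lm Le Hrho HM0pos He delta) Hden2).
  refine (near_imp p _ _ _ (near_and _ _ _ Ndz (near_and _ _ _ Ndr
    (near_and _ _ _ Nz (near_and _ _ _ Nrho0 (near_and _ _ _ Nt
      (near_and _ _ _ Nm (near_and _ _ _ Nd1 Nd2)))))))).
  intros v (HvDz & HvDr & Hz & Hv0 & Hvt & Hvm & Hv1 & Hv2).
  assert (Hve := HEpos _ HvDr); assert (Hvrho := HRfpos _ HvDz).
  split; [exact HvDz | split; [exact HvDr|]].
  split; [exact Hz|]; split; [|split; [|split; assumption]].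
  - split; [exact Hvrho|]; split; [exact Hv0|]; split; [exact Hvt|].
    split; [|exact Hve].
    pose proof (Rmult_lt_0_compat _ _ Hve Hvrho); lra.
  - intros tau Htau%seg_pos; try assumption.
    apply affine_pos; lra. }
destruct (picard_lindelof coord _ (field sigma delta t0 E R_0 Rf) p z0 dom
  in_coords) as (h & X & Hh & HX0 & HX & Huniq).
{ intros []; simpl.
  - apply locally_lipschitz_const.
  - apply (locally_lipschitz_rhs_r p sigma t0 _ _ _ _ (fun v => v Ct));
      assumption.
  - apply locally_lipschitz_rhs_t; assumption.
  - apply (locally_lipschitz_rhs_M p sigma t0 _ _ _ _ (fun v => v Ct));
      assumption. }
{ exact Hdom. }
assert (Hball : forall z, z0 - h < z < z0 + h <-> Rabs (z - z0) < h).
{ intros z; symmetry; apply Rabs_lt_between'. }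
assert (HXz : forall z, Rabs (z - z0) < h -> X z Cz = z).
{ apply unit_speed; [apply (HX0 Cz) | intros z Hz; apply (HX z Hz)]. }
exists (z0 - h), (z0 + h); split; [lra|].
exists (fun z => X z Cr), (fun z => X z Ct), (fun z => X z CM).
split; [|split; [apply (HX0 Cr) | split; [apply (HX0 Ct) | split]]].
- intros z Hz; apply Hball in Hz.
  destruct (HX z Hz) as [(HDz' & HDr' & Hwd) Hder].
  assert (Hr := Hder Cr); assert (Ht := Hder Ct); assert (Hm := Hder CM).
  simpl in Hr, Ht, Hm; rewrite (HXz z Hz) in *.
  tauto.
- apply (HX0 CM).
- intros r1 t1 M1 Hsol Hr1 Ht1 HM1 z Hz; apply Hball in Hz.
  assert (H : forall c, state z (r1 z) (t1 z) (M1 z) c = X z c).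
  { intros c.
    refine (Huniq (fun s => state s (r1 s) (t1 s) (M1 s)) _ _ z c Hz).
    - intros []; simpl; auto.
    - intros s c' Hs; apply Hball, Hsol in Hs.
      destruct Hs as (_ & _ & _ & Hr & Ht & Hm).
      destruct c'; simpl; try assumption.
      apply (is_derive_id (K := R_AbsRing)). }
  split; [apply (H Cr) | split; [apply (H Ct) | apply (H CM)]].
Qed.
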